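(* Let $g:\mathbb{R}\to\mathbb{R}$ be an admissible kernel with local constants $\varepsilon,\beta>0$. Then there is a constant $\nu_0>\max\{\varepsilon,\beta\}$, depending only on the kernel $g$ and the constants $\varepsilon,\beta$, such that the following holds for every $\nu\ge\nu_0$. Let $\sigma>0$, $N>0$, $\delta\ge 0$, and set $g_\sigma[k]:=g\left(\frac{k}{\sigma N}\right)$ for $k\in\mathbb{Z}$ and $\gamma:=\max\{N\sigma,\varepsilon^{-1}\}$. Let $K=\{k_m\}\subset\mathbb{Z}$ (the $k_m$ being distinct) satisfy the separation condition $$\min_{k_i,k_j\in K,\ i\ne j}|k_i-k_j|\ \ge\ N\nu\sigma ,$$ let $x[k]=\sum_m c_m\,\delta[k-k_m]$ be a signal in $\ell_1(\mathbb{Z})$ with nonzero real weights $c_m$ (where $\delta[\cdot]$ is the Kronecker delta), and let $$y[k]=\sum_m c_m\,g_\sigma[k-k_m]+\eta[k],\qquad k\in\mathbb{Z},$$ where $\eta:\mathbb{Z}\to\mathbb{R}$ satisfies $\|\eta\|_1=\sum_{k}|\eta[k]|\le\delta$. Let $\hat x[k]=\sum_n\hat c_n\,\delta[k-\hat k_n]$ be a solution of the convex program $$\min_{\tilde x\in\ell_1(\mathbb{Z})}\|\tilde x\|_1\quad\text{subject to}\quad \|y-g_\sigma\ast\tilde x\|_1\le\delta ,$$ with support $\hat K=\{\hat k_n\}$ (the $\hat k_n$ being distinct and $\hat c_n\ne 0$). Define $$\mathbb{Z}_{far}:=\{k\in\mathbb{Z}:\ |k-k_m|>N\varepsilon\sigma\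 \text{ for all } k_m\in K\},\qquad \hat K_{far}:=\mathbb{Z}_{far}\cap\hat K .$$ Then $$\sum_{\{n:\ \hat k_n\in\hat K_{far}\}}|\hat c_n|\ \le\ \frac{16\gamma^2}{\beta}\,\delta .$$
   Context: Admissible kernel: a function $g:\mathbb{R}\to\mathbb{R}$ is admissible (with local constants $\varepsilon,\beta>0$) if: 1. $g\in\mathcal{C}^3(\mathbb{R})$, and $g$ is real and even. 2. (Global property) There are constants $C_\ell>0$, $\ell=0,1,2,3$, such that $|g^{(\ell)}(t)|\le C_\ell/(1+t^2)$ for all $t\in\mathbb{R}$, where $g^{(\ell)}$ is the $\ell$-th derivative of $g$. 3. (Local property) The constants $\varepsilon,\beta>0$ are such that (a) $g(t)>0$ for all $|t|\le\varepsilon$ and $g(t)<g(\varepsilon)$ for all $|t|>\varepsilon$; (b) $g^{(2)}(t)<-\beta$ for all $|t|\le\varepsilon$. It is also required that $\varepsilon,\beta<\nu$, where $\nu$ is the separation constant. Discrete convolution: $(g_\sigma\ast\tilde x)[k]=\sum_{j\in\mathbb{Z}}g_\sigma[k-j]\,\tilde x[j]$. The norm $\|\cdot\|_1$ is the $\ell_1(\mathbb{Z})$ norm. *)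

(* Defs.v *)
From HB Require Import structures.
From mathcomp Require Import all_boot all_order all_algebra.
From mathcomp Require Import all_classical all_reals all_analysis.

Set Implicit Arguments.
Unset Strict Implicit.
Unset Printing Implicit Defensive.
Import Order.TTheory GRing.Theory Num.Theory.
Import numFieldNormedType.Exports.

Local Open Scope classical_set_scope.
Local Open Scope ring_scope.

Definition class_C3 (R : realType) (g : R -> R) : Prop :=
  (forall (l : nat) (t : R), (l < 3)%N -> derivable (derive1n l g) t 1) /\
  continuous (derive1n 3 g).

Definition admissible_kernel (R : realType) (eps beta : R) (g : R -> R) : Prop :=
  [/\ class_C3 g,
      forall t, g (- t) = g t,
      exists C : nat -> R, forall l : nat, (l <= 3)%N ->
        0 < C l /\ forall t, `|derive1n l g t| <= C l / (1 + t ^+ 2),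
      (forall t, `|t| <= eps -> 0 < g t) /\
      (forall t, eps < `|t| -> g t < g eps) &
      forall t, `|t| <= eps -> derive1n 2 g t < - beta].

(* [\esum] is only meaningful for nonnegative terms, so the sum of an
   absolutely summable real family is taken as the sum of the positive parts
   minus the sum of the negative parts. *)
Definition rsum (R : realType) (D : set int) (f : int -> R) : R :=
  fine (esum D (EFin \o f)^\+ - esum D (EFin \o f)^\-)%E.

Definition norm1 (R : realType) (x : int -> R) : \bar R :=
  (\esum_(k in [set: int]) `|x k|%:E)%E.

Definition ell1 (R : realType) (x : int -> R) : Prop :=
  summable [set: int] (EFin \o x).

Definition sampled_kernel (R : realType) (g : R -> R) (sigma N : R) : int -> R :=
  fun k => g (k%:~R / (sigma * N)).

Definition convZ (R : realType) (a x : int -> R) : int -> R :=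
  fun k => rsum [set: int] (fun j => a (k - j) * x j).

Definition kronecker (R : realType) : int -> R := fun k => (k == 0)%:R.

(* Spike trains are given by the set [K] of their (distinct) locations and by
   weights indexed by location: [weighted_shifts K c a] is
   k |-> \sum_(m in K) c m * a (k - m). *)
Definition weighted_shifts (R : realType) (K : set int) (c a : int -> R) :
    int -> R :=
  fun k => rsum K (fun m => c m * a (k - m)).

Definition spike_train (R : realType) (K : set int) (c : int -> R) : int -> R :=
  weighted_shifts K c (@kronecker R).

Definition feasible (R : realType) (a y : int -> R) (d : R) (x : int -> R) : Prop :=
  ell1 x /\ (norm1 (y \- convZ a x)%R <= d%:E)%E.

Definition solves_program (R : realType) (a y : int -> R) (d : R)
    (x : int -> R) : Prop :=
  feasible a y d x /\ forall z, feasible a y d z -> (norm1 x <= norm1 z)%E.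

Definition min_separated (R : realType) (K : set int) (r : R) : Prop :=
  forall i j, K i -> K j -> i != j -> r <= `|i - j|%:~R.

Definition Zfar (R : realType) (K : set int) (r : R) : set int :=
  [set k | forall m, K m -> r < `|k - m|%:~R].

(* Main.v *)
(* Duality: let q = G * p interpolate the signs of the spikes, with |q| <= 1
   everywhere, |q| <= 1 - rho far from the spikes and |p| <= P. Pairing q with the
   difference of the two signals and using the minimality of the solution shows
   that the far mass is at most 2 P delta / rho. Only finitely many spikes are
   interpolated, the rest having arbitrarily small mass.

   The kernel is only bounded above by g(eps) away from 0, and -g may exceed g(0)
   there, so translates of g alone do not give such a q. They are replaced by
   translates of the correlation Q = Phi(G) * G, where G is the sampled kernel and
   Phi an odd nondecreasing truncation vanishing at small values; a rearrangement
   argument gives |Q(j)| < Q(0) for j <> 0 with an explicit gap. Let h be the grid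
   step 1 / (sigma N).

   - If h is bounded below, take for Phi the sign of the values of modulus above
     g(0) - beta / (2 gamma^2) and add one copy of G. The gap
     beta / (2 gamma^2), attained already at the grid neighbours, yields the
     constant 16, and a diagonally dominant linear system gives the interpolation.
   - If h is small, gamma^2 = h^-2 leaves room for any fixed constant. Take for
     Phi the soft threshold at g(eps): Q is then a Riemann sum with a gap
     independent of h, quadratic near 0. Derivatives are made to vanish at the
     spikes with the help of a second, odd combination of translates. *)

Require Import Defs.
From HB Require Import structures.
From mathcomp Require Import all_boot all_order all_algebra.
From mathcomp Require Import all_classical all_reals all_analysis.
From mathcomp Require Import ring lra zify.

Import Order.TTheory GRing.Theory Num.Theory.
Import numFieldNormedType.Exports.

Local Open Scope classical_set_scope.
Local Open Scope ring_scope.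

(** * Sums of absolutely summable families over the integers *)

Lemma ell1_le {R : realType} (f g : int -> R) :
  ell1 f -> (forall k, `|g k| <= `|f k|) -> ell1 g.
Proof.
move=> hf hgf; apply: le_lt_trans hf; apply: le_esum => k _ /=.
by rewrite lee_fin.
Qed.

Lemma ell1D {R : realType} (f g : int -> R) :
  ell1 f -> ell1 g -> ell1 (fun k => f k + g k).
Proof.
move=> hf hg; have := summableD hf hg; rewrite /ell1.
by congr summable; apply/funext => k.
Qed.

Lemma ell1_abs {R : realType} (f : int -> R) :
  ell1 f -> ell1 (fun k => `|f k|).
Proof. by move=> hf; apply: ell1_le hf _ => k; rewrite normr_id. Qed.

Lemma esumZl {R : realType} (f : int -> R) (c : R) : 0 <= c ->
  (\esum_(k in [set: int]) (c * f k)%:E =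
   c%:E * \esum_(k in [set: int]) (f k)%:E)%E.
Proof.
move=> c0; rewrite /esum -ereal_supZl//; last first.
  by apply/set0P; exists 0%E; exists set0; rewrite ?fsbig_set0//; exact: fsets_set0.
congr ereal_sup; apply/seteqP; split.
  move=> _ [A [finA _] <-]; exists (\sum_(x \in A) (f x)%:E)%E.
    by exists A.
  by rewrite !fsumEFin// -EFinM mulr_fsumr.
move=> _ [_ [A [finA _] <-] <-]; exists A => //.
by rewrite !fsumEFin// -EFinM mulr_fsumr.
Qed.

Lemma ell1Z {R : realType} (f : int -> R) (c : R) :
  ell1 f -> ell1 (fun k => c * f k).
Proof.
move=> hf; rewrite /ell1 /summable.
rewrite (eq_esum (b := fun k => (`|c| * `|f k|)%:E)); last first.
  by move=> k _ /=; rewrite normrM.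
rewrite esumZl//; move: hf; rewrite /ell1 summableE.
by move=> /fineK <-; rewrite -EFinM ltry.
Qed.

Lemma ell1N {R : realType} (f : int -> R) : ell1 f -> ell1 (fun k => - f k).
Proof. by move=> hf; apply: ell1_le hf _ => k; rewrite normrN. Qed.

Lemma ell1B {R : realType} (f g : int -> R) :
  ell1 f -> ell1 g -> ell1 (fun k => f k - g k).
Proof. by move=> hf hg; apply: ell1D => //; apply: ell1N. Qed.

Lemma ell1_bounded_mul {R : realType} (a f : int -> R) (B : R) :
  (forall k, `|a k| <= B) -> ell1 f -> ell1 (fun k => a k * f k).
Proof.
move=> ha hf; have := ell1Z _ B hf; move=> /ell1_le; apply => k.
have B0 : 0 <= B by apply: le_trans (ha 0).
by rewrite !normrM (ger0_norm B0) ler_wpM2r.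
Qed.

Lemma ell1_reindex {R : realType} (e : int -> int) (f : int -> R) :
  bijective e -> ell1 f -> ell1 (fun k => f (e k)).
Proof.
rewrite -setTT_bijective => be; rewrite /ell1 /summable.
by rewrite (reindex_esum _ _ e _ be).
Qed.

Lemma ell1_finite_support {R : realType} (s : seq int) (f : int -> R) :
  (forall k, k \notin s -> f k = 0) -> ell1 f.
Proof.
move=> hs; rewrite /ell1 /summable (esumID [set` s])// ?setTI.
rewrite [X in (_ + X)%E]esum1 ?adde0; last first.
  by move=> k /negP ks /=; rewrite hs// normr0.
rewrite esum_fset//; last exact: finite_seq.
by rewrite (fsumEFin _ (finite_seq s)) ltry.
Qed.

Lemma fine_esum {R : realType} (f : int -> R) : ell1 f -> (forall k, 0 <= f k) ->
  (\esum_(k in [set: int]) (f k)%:E)%E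
  = (fine (\esum_(k in [set: int]) (f k)%:E)%E)%:E.
Proof.
move=> hf f0; rewrite fineK//; move: hf; rewrite /ell1 summableE.
by congr (_ \is a fin_num); apply: eq_esum => k _ /=; rewrite ger0_norm.
Qed.

(** Any splitting into nonnegative summable families computes [rsum], not only the one into positive
    and negative parts. The linearity of [rsum] rests on this freedom. *)
Lemma rsum_sub {R : realType} (f g : int -> R) : ell1 f -> ell1 g ->
  (forall k, 0 <= f k) -> (forall k, 0 <= g k) ->
  rsum [set: int] (fun k => f k - g k) =
  fine (\esum_(k in [set: int]) (f k)%:E)%E
  - fine (\esum_(k in [set: int]) (g k)%:E)%E.
Proof.
move=> hf hg f0 g0; rewrite /rsum.
have -> : EFin \o (fun k => f k - g k) = ((EFin \o f) \- (EFin \o g))%E.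
  by apply/funext.
have Ef0 i : [set: int] i -> (0 <= (EFin \o f) i)%E by rewrite lee_fin.
have Eg0 i : [set: int] i -> (0 <= (EFin \o g) i)%E by rewrite lee_fin.
rewrite (esumB hf hg Ef0 Eg0); transitivity (fine (\esum_(k in [set: int]) (f k)%:E
  - \esum_(k in [set: int]) (g k)%:E)%E) => //.
by rewrite (fine_esum _ hf f0) (fine_esum _ hg g0).
Qed.

Lemma rsum_ge0E {R : realType} (f : int -> R) : ell1 f -> (forall k, 0 <= f k) ->
  rsum [set: int] f = fine (\esum_(k in [set: int]) (f k)%:E)%E.
Proof.
move=> hf f0.
have h0 : ell1 (fun=> 0 : R) by apply: (ell1_finite_support [::]).
have := rsum_sub f (fun=> 0) hf h0 f0 (fun=> lexx 0).
rewrite [X in _ - fine X]esum1// subr0 => <-.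
by congr rsum; apply/funext => k; rewrite subr0.
Qed.

Lemma esum_rsum {R : realType} (f : int -> R) : ell1 f -> (forall k, 0 <= f k) ->
  (\esum_(k in [set: int]) (f k)%:E)%E = (rsum [set: int] f)%:E.
Proof. by move=> hf f0; rewrite rsum_ge0E// -fine_esum. Qed.

Lemma norm1_rsum {R : realType} (f : int -> R) : ell1 f ->
  norm1 f = (rsum [set: int] (fun k => `|f k|))%:E.
Proof. by move=> hf; rewrite /norm1 esum_rsum//; exact: ell1_abs. Qed.

Lemma rsum_posneg {R : realType} (f : int -> R) : ell1 f ->
  exists fp fn : int -> R, [/\ ell1 fp, ell1 fn, (forall k, 0 <= fp k),
   (forall k, 0 <= fn k) & f = (fun k => fp k - fn k)].
Proof.
move=> hf; exists (fun k => (`|f k| + f k) / 2), (fun k => (`|f k| - f k) / 2).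
split.
- apply: ell1_le hf _ => k; have /ler_normlP[]:= lexx `|f k| => h1 h2.
  by rewrite ger0_norm; lra.
- apply: ell1_le hf _ => k; have /ler_normlP[]:= lexx `|f k| => h1 h2.
  by rewrite ger0_norm; lra.
- by move=> k; have /ler_normlP[]:= lexx `|f k|; lra.
- by move=> k; have /ler_normlP[]:= lexx `|f k|; lra.
by apply/funext => k; lra.
Qed.

Lemma esum_fineD {R : realType} (f g : int -> R) : ell1 f -> ell1 g ->
  (forall k, 0 <= f k) -> (forall k, 0 <= g k) ->
  fine (\esum_(k in [set: int]) (f k + g k)%:E)%E =
  fine (\esum_(k in [set: int]) (f k)%:E)%E
  + fine (\esum_(k in [set: int]) (g k)%:E)%E.
Proof.
move=> hf hg f0 g0.
rewrite (eq_esum (b := fun k => (f k)%:E + (g k)%:E)%E)// esumD.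
- by rewrite (fine_esum _ hf f0) (fine_esum _ hg g0).
- by move=> k _; rewrite lee_fin.
- by move=> k _; rewrite lee_fin.
Qed.

Lemma rsumD {R : realType} (f g : int -> R) : ell1 f -> ell1 g ->
  rsum [set: int] (fun k => f k + g k) = rsum [set: int] f + rsum [set: int] g.
Proof.
move=> /rsum_posneg[fp [fn [hfp hfn fp0 fn0 ->]]].
move=> /rsum_posneg[gp [gn [hgp hgn gp0 gn0 ->]]].
rewrite !rsum_sub//.
have -> : (fun k => fp k - fn k + (gp k - gn k)) =
  (fun k => (fp k + gp k) - (fn k + gn k)) by apply/funext => k; lra.
rewrite rsum_sub; last 4 first.
- exact: ell1D.
- exact: ell1D.
- by move=> k; apply: addr_ge0.
- by move=> k; apply: addr_ge0.
by rewrite (esum_fineD _ _ hfp hgp fp0 gp0) (esum_fineD _ _ hfn hgn fn0 gn0)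
  opprD addrACA.
Qed.

Lemma rsumN {R : realType} (f : int -> R) : ell1 f ->
  rsum [set: int] (fun k => - f k) = - rsum [set: int] f.
Proof.
move=> /rsum_posneg[fp [fn [hfp hfn fp0 fn0 ->]]].
have -> : (fun k => - (fp k - fn k)) = (fun k => fn k - fp k).
  by apply/funext => k; lra.
by rewrite !rsum_sub//; lra.
Qed.

Lemma rsumB {R : realType} (f g : int -> R) : ell1 f -> ell1 g ->
  rsum [set: int] (fun k => f k - g k) = rsum [set: int] f - rsum [set: int] g.
Proof. by move=> hf hg; rewrite rsumD ?rsumN//; exact: ell1N. Qed.

Lemma rsumZ {R : realType} (f : int -> R) (c : R) : ell1 f ->
  rsum [set: int] (fun k => c * f k) = c * rsum [set: int] f.
Proof.
wlog c0 : c / 0 <= c => [hw|] hf.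
  have [/hw->//|c0] := leP 0 c.
  have -> : (fun k => c * f k) = (fun k => - (- c * f k)) by apply/funext => k; lra.
  by rewrite rsumN ?hw//; [lra|lra|exact: ell1Z].
have [fp [fn [hfp hfn fp0 fn0 ->]]] := rsum_posneg _ hf.
have -> : (fun k => c * (fp k - fn k)) = (fun k => c * fp k - c * fn k).
  by apply/funext => k; lra.
rewrite !rsum_sub//; last 4 first.
- exact: ell1Z.
- exact: ell1Z.
- by move=> k; apply: mulr_ge0.
- by move=> k; apply: mulr_ge0.
by rewrite !esumZl// (fine_esum _ hfp)// (fine_esum _ hfn)// /=; lra.
Qed.

Lemma rsum_ge0 {R : realType} (f : int -> R) : ell1 f -> (forall k, 0 <= f k) ->
  0 <= rsum [set: int] f.
Proof.
move=> hf f0; rewrite rsum_ge0E//; apply: fine_ge0; apply: esum_ge0 => k _.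
by rewrite lee_fin.
Qed.

Lemma ler_rsum {R : realType} (f g : int -> R) : ell1 f -> ell1 g ->
  (forall k, f k <= g k) -> rsum [set: int] f <= rsum [set: int] g.
Proof.
move=> hf hg fg; rewrite -subr_ge0 -rsumB//; apply: rsum_ge0; first exact: ell1B.
by move=> k; rewrite subr_ge0.
Qed.

Lemma rsum_reindex {R : realType} (e : int -> int) (f : int -> R) :
  bijective e -> rsum [set: int] (fun k => f (e k)) = rsum [set: int] f.
Proof.
rewrite -setTT_bijective => be; congr (fine (_ - _)%E); apply/esym.
  rewrite (reindex_esum _ _ e _ be); apply: eq_esum => k _ /=.
  by rewrite !funeposE.
rewrite (reindex_esum _ _ e _ be); apply: eq_esum => k _ /=.
by rewrite !funenegE.
Qed.

Lemma rsum_finite_support {R : realType} (s : seq int) (f : int -> R) : uniq s ->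
  (forall k, k \notin s -> f k = 0) ->
  rsum [set: int] f = \sum_(k <- s) f k.
Proof.
move=> us; wlog f0 : f / forall k, 0 <= f k => [hw|] hs.
  have hf := ell1_finite_support s f hs.
  have -> : f = (fun k => (`|f k| + f k) / 2 - (`|f k| - f k) / 2).
    by apply/funext => k; lra.
  rewrite rsumB ?hw//.
  - by rewrite sumrB.
  - by move=> k; have /ler_normlP[]:= lexx `|f k|; lra.
  - by move=> k /hs ->; rewrite normr0; lra.
  - by move=> k; have /ler_normlP[]:= lexx `|f k|; lra.
  - by move=> k /hs ->; rewrite normr0; lra.
  - by apply: (ell1_finite_support s) => k /hs ->; rewrite normr0; lra.
  - by apply: (ell1_finite_support s) => k /hs ->; rewrite normr0; lra.
rewrite rsum_ge0E//; last exact: (ell1_finite_support s).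
rewrite (esumID [set` s])// ?setTI; last by move=> k _; rewrite lee_fin.
rewrite [X in (_ + X)%E]esum1 ?adde0; last first.
  by move=> k /negP ks /=; rewrite hs.
rewrite esum_fset//; last 2 first.
- exact: finite_seq.
- by move=> k _; rewrite lee_fin.
rewrite (fsumEFin _ (finite_seq s)) [RHS]/= ; exact/esym/fsbig_seq.
Qed.

Lemma ler_sum_rsum {R : realType} (s : seq int) (f : int -> R) : uniq s ->
  ell1 f -> (forall k, 0 <= f k) -> \sum_(k <- s) f k <= rsum [set: int] f.
Proof.
move=> us hf f0.
have <- : rsum [set: int] (fun k => (k \in s)%:R * f k) = \sum_(k <- s) f k.
  rewrite (rsum_finite_support s)//.
    by rewrite big_seq [RHS]big_seq; apply: eq_bigr => k ->; rewrite mul1r.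
  by move=> k /negPf ->; rewrite mul0r.
apply: ler_rsum => //.
  by apply: (ell1_finite_support s) => k /negPf ->; rewrite mul0r.
by move=> k; case: (k \in s); rewrite ?mul1r ?mul0r.
Qed.

Lemma rsum_indic {R : realType} (D : set int) (f : int -> R) :
  rsum D f = rsum [set: int] (fun k => if k \in D then f k else 0).
Proof.
rewrite /rsum [in LHS]esum_mkcond [X in fine (_ - X)%E]esum_mkcond.
congr (fine (_ - _)%E); apply: eq_esum => k _ /=.
  by rewrite !funeposE /=; case: ifP => // _; rewrite max_l.
by rewrite !funenegE /=; case: ifP => // _; rewrite oppr0 max_l.
Qed.

Lemma rsum_big {R : realType} (J : finType) (f : J -> int -> R) :
  (forall j, ell1 (f j)) ->
  ell1 (fun k => \sum_j f j k) /\
  rsum [set: int] (fun k => \sum_j f j k) = \sum_j rsum [set: int] (f j).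
Proof.
move=> hf.
suff H (s : seq J) : ell1 (fun k => \sum_(j <- s) f j k) /\
    rsum [set: int] (fun k => \sum_(j <- s) f j k)
    = \sum_(j <- s) rsum [set: int] (f j).
  exact: H.
elim: s => [|j s [IH1 IH2]].
  have -> : (fun k => \sum_(j <- [::]) f j k) = (fun=> 0).
    by apply/funext => k; rewrite big_nil.
  rewrite big_nil; split; first exact: (ell1_finite_support [::]).
  by rewrite (rsum_finite_support [::]) ?big_nil.
have -> : (fun k => \sum_(i <- j :: s) f i k) =
    (fun k => f j k + \sum_(i <- s) f i k).
  by apply/funext => k; rewrite big_cons.
by split; [exact: ell1D|rewrite rsumD// IH2 big_cons].
Qed.

(** * Dual certificates *)

(* [q = sum_j p_j G(. - pos j)] is a dual certificate with values [s] at the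
   points [t]; the coefficients are bounded in supremum norm because they are
   paired with an l1 residual. *)
Definition certificate {R : realType} (G : int -> R) {I : finType}
    (t : I -> int) (s : I -> R) (far : set int) (P rho : R) : Prop :=
  exists (J : finType) (pos : J -> int) (p : J -> R),
    let q k := \sum_j p j * G (k - pos j) in
    [/\ injective pos, forall j, `|p j| <= P, forall i, q (t i) = s i,
        forall k, `|q k| <= 1 & forall k, far k -> `|q k| <= 1 - rho].

(** With [<q,v>] the sum of [q k * v k], the norm of [x] is at most [<q,x> + 2 * tau], then
    [<q,x> <= <q,z> + P * D], and [<q,z>] is at most the norm of [z] minus [rho] times its far part.
    Since the norm of [z] is at most that of [x], the norms cancel. As [q] is a finite combination
    of translates, bounds on finite sums of the residual suffice. *)
Lemma certificate_bound {R : realType} (G x z : int -> R) (I : finType)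
    (t : I -> int) (far : set int) (P rho D tau B : R) :
  (forall k, G (- k) = G k) -> (forall k, `|G k| <= B) ->
  0 <= P -> ell1 x -> ell1 z ->
  rsum [set: int] (fun k => `|z k|) <= rsum [set: int] (fun k => `|x k|) ->
  (forall l : seq int, uniq l ->
    \sum_(k <- l) `|convZ G x k - convZ G z k| <= D) ->
  rsum [set: int] (fun k => if k \in codom t then 0 else `|x k|) <= tau ->
  certificate G t (fun i => Num.sg (x (t i))) far P rho ->
  rho * rsum far (fun k => `|z k|) <= P * D + 2 * tau.
Proof.
move=> Geven GB P0 hx hz hzx hD htau [J [pos [p]]].
set q := fun k => _; move=> [pos_inj hp hqt hq1 hqfar].
have hG v j : ell1 v -> ell1 (fun k => G (k - pos j) * v k).
  by apply: ell1_bounded_mul.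
(* Since [G] is even, pairing [v] with a translate of [G] evaluates the convolution [G * v] at the
   centre of that translate. *)
have hq v : ell1 v -> ell1 (fun k => q k * v k) /\
    rsum [set: int] (fun k => q k * v k) = \sum_j p j * convZ G v (pos j).
  move=> hv.
  have -> : (fun k => q k * v k) =
      (fun k => \sum_j (fun j k => p j * (G (k - pos j) * v k)) j k).
    apply/funext => k; rewrite /q mulr_suml; apply: eq_bigr => j _.
    by rewrite mulrA.
  have [|h1 ->] := @rsum_big _ _ (fun j k => p j * (G (k - pos j) * v k)).
    by move=> j; apply: ell1Z; apply: hG.
  split=> //; apply: eq_bigr => j _.
  rewrite rsumZ; last exact: hG.
  by congr (_ * rsum _ _); apply/funext => k; rewrite -Geven opprB.
have [hqx qxE] := hq _ hx; have [hqz qzE] := hq _ hz.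
have hax := ell1_abs _ hx; have haz := ell1_abs _ hz.
have htail : ell1 (fun k => if k \in codom t then 0 else `|x k|).
  apply: ell1_le hx _ => k; case: ifP => _; first by rewrite normr0.
  by rewrite normr_id.
have hfarz : ell1 (fun k => if k \in far then `|z k| else 0).
  apply: ell1_le hz _ => k; case: ifP => _; last by rewrite normr0.
  by rewrite normr_id.
(* At the points [t i] the product [q * x] equals [|x|]; elsewhere [|x| - q * x] is at most
   [2 * |x|], which produces [2 * tau]. *)
have step1 : rsum [set: int] (fun k => `|x k|) <=
    rsum [set: int] (fun k => q k * x k) + 2 * tau.
  rewrite -lerBlDl -rsumB//; apply: (@le_trans _ _ (2 *
    rsum [set: int] (fun k => if k \in codom t then 0 else `|x k|))); last first.
    by rewrite ler_wpM2l.
  rewrite -rsumZ//; apply: ler_rsum.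
  - exact: ell1B.
  - exact: ell1Z.
  - move=> k; case: ifP => [/codomP[i ->]|_].
      by rewrite hqt mulr0 -normrEsg subrr.
    have := lerB_normD `|x k| 0; have := hq1 k.
    have := ler_norm (- (q k * x k)); rewrite normrN normrM => h1 h2 _.
    have : `|q k| * `|x k| <= 1 * `|x k| by rewrite ler_wpM2r.
    by rewrite mul1r; lra.
have step2 : rsum [set: int] (fun k => q k * x k) <=
    rsum [set: int] (fun k => q k * z k) + P * D.
  rewrite qxE qzE -lerBlDl -sumrB.
  apply: (@le_trans _ _ (\sum_j P * `|convZ G x (pos j) - convZ G z (pos j)|)).
    apply: ler_sum => j _; rewrite -mulrBr (le_trans (ler_norm _))// normrM.
    by rewrite ler_wpM2r.
  rewrite -mulr_sumr ler_wpM2l//.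
  have := hD (map pos (enum J)); rewrite big_map big_enum; apply.
  by rewrite map_inj_uniq// enum_uniq.
have step3 : rsum [set: int] (fun k => q k * z k) <=
    rsum [set: int] (fun k => `|z k|) - rho * rsum far (fun k => `|z k|).
  rewrite [rsum far _]rsum_indic -rsumZ// -rsumB//; last exact: ell1Z.
  apply: ler_rsum => //; first by apply: ell1B => //; exact: ell1Z.
  move=> k; apply: le_trans (ler_norm _) _; rewrite normrM.
  case: ifP => [|_].
    by rewrite inE => /hqfar h; have := ler_wpM2r (normr_ge0 (z k)) h; lra.
  by have := ler_wpM2r (normr_ge0 (z k)) (hq1 k); lra.
by move: hzx step1 step2 step3; lra.
Qed.

(** The l1 norm is a supremum of finite sums, so some finite set carries all but [tau] of it. Points
    where [x] vanishes are then discarded, so that the sign of [x] on [l] is a unit. *)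
Lemma rsum_tail {R : realType} (x : int -> R) (tau : R) : ell1 x -> 0 < tau ->
  exists l : seq int, [/\ uniq l, {in l, forall k, x k != 0} &
    rsum [set: int] (fun k => if k \in l then 0 else `|x k|) <= tau].
Proof.
move=> hx tau0; have hax := ell1_abs _ hx.
have := esum_rsum _ hax (fun k => normr_ge0 _); rewrite /esum => E.
have : ((rsum [set: int] (fun k => `|x k|) - tau)%:E <
    ereal_sup [set (\sum_(k \in A) (`|x k|)%:E)%E | A in fsets [set: int]])%E.
  by rewrite E lte_fin ltrBlDr ltrDl.
move=> /ereal_sup_gt[_ [A [finA _] <-]]; rewrite fsumEFin// lte_fin => hA.
pose l0 := finmap.enum_fset (fset_set A).
have ul0 : uniq l0 by exact: finmap.fset_uniq.
exists [seq k <- l0 | x k != 0]; split.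
- exact: filter_uniq.
- by move=> k; rewrite mem_filter => /andP[].
have -> : (fun k => if k \in [seq k <- l0 | x k != 0] then 0 else `|x k|) =
    (fun k => `|x k| - (if k \in l0 then `|x k| else 0)).
  apply/funext => k; rewrite mem_filter.
  by case: eqP => [->|_]; case: (k \in l0); rewrite /= ?normr0 ?subr0 ?subrr.
have hl0 : ell1 (fun k => if k \in l0 then `|x k| else 0).
  by apply: (ell1_finite_support l0) => k /negPf ->.
rewrite rsumB// (rsum_finite_support l0 (fun k => if k \in l0 then _ else _))//.
  rewrite -big_mkcond -big_seq; move: hA; rewrite fsbig_finite//= => hA.
  by rewrite -/l0 in hA; lra.
by move=> k /negPf ->.
Qed.

(** * Diagonally dominant systems and separated points *)

(** In the row where [|u i|] is maximal, the diagonal term exceeds the others by at least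
    [(d - w) * |u i|]. *)
Lemma diag_dominant_bound {R : realType} {T : finType} (A : T -> T -> R)
    (d w B : R) (u : T -> R) :
  (forall i, d <= `|A i i|) -> (forall i, \sum_(j | j != i) `|A i j| <= w) ->
  w < d -> (forall i, `|\sum_j A i j * u j| <= B) ->
  forall i, `|u i| <= B / (d - w).
Proof.
move=> hd hw wd hB i0.
case: (@arg_maxP _ R T i0 xpredT (fun i => `|u i|)) => // i _ imax.
apply: le_trans (imax i0 isT) _; rewrite ler_pdivlMr ?subr_gt0//.
have := hB i; rewrite (bigD1 i)//= => h.
have h1 : `|\sum_(j | j != i) A i j * u j| <= w * `|u i|.
  apply: le_trans (ler_norm_sum _ _ _) _.
  apply: (@le_trans _ _ (\sum_(j | j != i) `|A i j| * `|u i|)).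
    by apply: ler_sum => j _; rewrite normrM ler_wpM2l//; exact: imax.
  by rewrite -mulr_suml ler_wpM2r.
have h2 : d * `|u i| <= `|A i i * u i| by rewrite normrM ler_wpM2r.
have := lerB_normD (A i i * u i) (\sum_(j | j != i) A i j * u j).
by move: h h1 h2; lra.
Qed.

Lemma diag_dominant_solve {R : realType} {T : finType} (A : T -> T -> R)
    (d w : R) (s : T -> R) :
  (forall i, d <= `|A i i|) -> (forall i, \sum_(j | j != i) `|A i j| <= w) ->
  w < d -> exists u : T -> R, forall i, \sum_j A i j * u j = s i.
Proof.
move=> hd hw wd.
(* The matrix is transposed because vectors are rows here. Its kernel is trivial by the preceding
   bound with [B = 0], hence it is invertible. *)
pose M : 'M[R]_#|T| := \matrix_(i, j) A (enum_val j) (enum_val i).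
have Mu : M \in unitmx.
  rewrite -row_free_unit -kermx_eq0; apply/eqP/row_matrixP => i; rewrite row0.
  set v := row i _; have vM : v *m M = 0 by rewrite -row_mul mulmx_ker row0.
  apply/rowP => j; rewrite [RHS]mxE; apply/eqP; rewrite -normr_le0.
  have -> : v 0 j = v 0 (enum_rank (enum_val j)) by rewrite enum_valK.
  have := @diag_dominant_bound _ _ A d w 0 (fun k => v 0 (enum_rank k)) hd hw wd.
  rewrite mul0r; apply=> k.
  move/rowP: vM => /(_ (enum_rank k)); rewrite !mxE => E.
  rewrite (reindex (@enum_val T predT))/=; last exact: (onW_bij _ (@enum_val_bij T)).
  rewrite normr_le0; apply/eqP; rewrite -[RHS]E; apply: eq_bigr => l _.
  by rewrite !mxE !enum_valK enum_rankK mulrC.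
pose sv : 'rV[R]_#|T| := \row_i s (enum_val i).
exists (fun k => (sv *m invmx M) 0 (enum_rank k)) => k.
have : (sv *m invmx M) *m M = sv by rewrite mulmxKV.
move=> /rowP/(_ (enum_rank k)); rewrite [LHS]mxE [RHS]mxE enum_rankK => <-.
rewrite (reindex (@enum_val T predT))/=; last exact: (onW_bij _ (@enum_val_bij T)).
by apply: eq_bigr => l _; rewrite [M _ _]mxE !enum_valK enum_rankK mulrC.
Qed.

Lemma ler_sum_subseq {R : realType} {T : eqType} (s s' : seq T) (F : T -> R) :
  uniq s -> uniq s' -> {subset s <= s'} -> (forall x, 0 <= F x) ->
  \sum_(x <- s) F x <= \sum_(x <- s') F x.
Proof.
move=> us us' ss F0.
have E : perm_eq s [seq x <- s' | x \in s].
  apply: uniq_perm => //; first exact: filter_uniq.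
  by move=> x; rewrite mem_filter; case: (boolP (x \in s)) => // /ss ->.
rewrite (perm_big _ E) big_filter big_mkcond; apply: ler_sum => x _.
by case: ifP.
Qed.

Lemma sum_inv_sqr_le {R : realType} (N : nat) :
  \sum_(0 <= n < N) (n.+1%:R ^+ 2)^-1 <= 2 :> R.
Proof.
case: N => [|N]; first by rewrite big_geq.
(* The sharper bound passes through the induction, since
   [1 / (n + 1) ^ 2 <= 1 / n - 1 / (n + 1)]. *)
suff : \sum_(0 <= n < N.+1) (n.+1%:R ^+ 2)^-1 <= 2 - N.+1%:R^-1 :> R.
  by move=> /le_trans; apply; rewrite gerBl.
elim: N => [|N IH]; first by rewrite big_nat1 expr1n invr1; lra.
rewrite big_nat_recr//=; apply: le_trans (lerD IH (lexx _)) _.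
have N0 : (0 : R) <= N%:R by [].
rewrite -[N.+2%:R]natr1 -[N.+1%:R]natr1; set x : R := N%:R in N0 *.
rewrite -subr_ge0.
have -> : 2 - (x + 1 + 1)^-1 - (2 - (x + 1)^-1 + ((x + 1 + 1) ^+ 2)^-1) =
  ((x + 1 + 1) ^+ 2 * (x + 1))^-1 :> R by field; apply/andP; split; lra.
by rewrite invr_ge0; apply: mulr_ge0; [exact: sqr_ge0|lra].
Qed.

Lemma sum_inv_sqr_inj_le {R : realType} {I : finType} (D : {pred I})
    (f : I -> nat) : {in D &, injective f} ->
  \sum_(i in D) ((f i).+1%:R ^+ 2)^-1 <= 2 :> R.
Proof.
move=> f_inj; rewrite -big_enum -(big_map f predT (fun n => (n.+1%:R ^+ 2)^-1)).
apply: le_trans (sum_inv_sqr_le (\max_(i in D) f i).+1).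
apply: ler_sum_subseq.
- rewrite map_inj_in_uniq ?enum_uniq// => i j; rewrite !mem_enum.
  exact: f_inj.
- exact: iota_uniq.
- move=> n /mapP[i]; rewrite mem_enum => iD ->.
  by rewrite mem_index_iota /= ltnS; exact: leq_bigmax_cond.
- by move=> n; rewrite invr_ge0 sqr_ge0.
Qed.

(* The integer parts of [(u i - x) / nu] are distinct, which compares the sum
   with two copies of the series of inverse squares. *)
Lemma separated_tail {R : realType} {I : finType} (u : I -> R) (D : pred I)
    (nu x : R) : 0 < nu ->
  (forall i j, i != j -> nu <= `|u i - u j|) ->
  (forall i, D i -> nu / 2 <= `|x - u i|) ->
  \sum_(i | D i) ((x - u i) ^+ 2)^-1 <= 16 / nu ^+ 2.
Proof.
move=> nu0 sep far; pose r i := Num.floor ((u i - x) / nu).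
have r_inj : injective r.
  move=> i j rij; apply/eqP/negP => /negP /sep; apply/negP; rewrite -ltNge.
  have := floor_itv ((u i - x) / nu); have := floor_itv ((u j - x) / nu).
  rewrite -/(r i) -/(r j) rij intrD => /andP[h1 h2] /andP[h3 h4].
  have : `|(u i - x) / nu - (u j - x) / nu| < 1.
    by rewrite ltr_norml; apply/andP; split; lra.
  rewrite -mulrBl normrM [X in _ * X]gtr0_norm ?invr_gt0// ltr_pdivrMr// mul1r.
  by congr (`|_| < _); lra.
(* Both [n] and [-n - 1] are sent to [n], so every value is taken at most twice, and
   [|x - u i| >= nu / 2 * (k i + 1)]. For [k i = 0] this is the assumption on [D]; otherwise
   [|x - u i| >= k i * nu] suffices. *)
pose k i := if 0 <= r i then absz (r i) else (absz (r i)).-1.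
have hk i : D i -> ((x - u i) ^+ 2)^-1 <= 4 / nu ^+ 2 * ((k i).+1%:R ^+ 2)^-1.
  move=> /far hi.
  have hx : nu / 2 * (k i).+1%:R <= `|x - u i|.
    have := floor_itv ((u i - x) / nu); rewrite -/(r i) /k.
    case: (r i) => n; rewrite ?intrD /= ?NegzE ?mulrNz -?pmulrn.
      rewrite ler_pdivlMr// ltr_pdivrMr// => /andP[h1 h2].
      have := ler_norm (- (x - u i)); rewrite normrN => h3.
      case: n h1 h2 => [|n] h1 h2; first by rewrite mulr1.
      have n0 : (0 : R) <= n%:R * nu by rewrite mulr_ge0// ltW.
      by move: h1; rewrite -[n.+2%:R]natr1 -[n.+1%:R]natr1; lra.
    rewrite ler_pdivlMr// ltr_pdivrMr// => /andP[h1 h2].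
    have := ler_norm (x - u i) => h3.
    case: n h1 h2 => [|n] h1 h2; first by rewrite mulr1.
    have n0 : (0 : R) <= n%:R * nu by rewrite mulr_ge0// ltW.
    by move: h1 h2; rewrite -[n.+2%:R]natr1 -[n.+1%:R]natr1; lra.
  have k0 : 0 < nu / 2 * (k i).+1%:R by rewrite mulr_gt0// divr_gt0.
  have -> : 4 / nu ^+ 2 * ((k i).+1%:R ^+ 2)^-1 = ((nu / 2 * (k i).+1%:R) ^+ 2)^-1.
    have : (k i).+1%:R != 0 :> R by rewrite pnatr_eq0.
    by move: (_.+1%:R) => y y0; field; rewrite y0 gt_eqF.
  rewrite -[(x - u i) ^+ 2]real_normK ?num_real//.
  rewrite lef_pV2 ?posrE ?exprn_gt0//; last exact: lt_le_trans hx.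
  by rewrite lerXn2r// ?nnegrE ltW.
apply: le_trans (ler_sum _ hk) _; rewrite -mulr_sumr.
have -> : 16 / nu ^+ 2 = 4 / nu ^+ 2 * (2 + 2) by lra.
rewrite ler_wpM2l//; first by rewrite divr_ge0// sqr_ge0.
rewrite (bigID (fun i => 0 <= r i)) /=; apply: lerD.
  apply: (@sum_inv_sqr_inj_le R I [pred i | D i && (0 <= r i)] k).
  move=> i j; rewrite !inE /k => /andP[_ ri] /andP[_ rj]; rewrite ri rj => e.
  by apply: r_inj; rewrite -(gez0_abs ri) e gez0_abs.
apply: (@sum_inv_sqr_inj_le R I [pred i | D i && ~~ (0 <= r i)] k).
move=> i j; rewrite !inE /k => /andP[_ ri] /andP[_ rj].
rewrite (negPf ri) (negPf rj) => e; apply: r_inj.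
by move: ri rj e; case: (r i) => // m; case: (r j) => // m' _ _ /= ->.
Qed.

(** * Admissible kernels *)

(** Gathers the properties of an admissible kernel and of its first two derivatives in the form used
    below: a single decay constant [C], and the concavity near 0 integrated once ([profile_slope])
    and twice ([profile_near]). *)
Record profile {R : realType} (eps beta C : R) (g g1 g2 : R -> R) : Prop :=
  Profile {
    profile_eps : 0 < eps;
    profile_beta : 0 < beta;
    profile_C : 0 < C;
    profile_derive : forall t, is_derive t (1 : R) g (g1 t);
    profile_derive2 : forall t, is_derive t (1 : R) g1 (g2 t);
    profile_decay : forall t, `|g t| <= C / (1 + t ^+ 2);
    profile_decay1 : forall t, `|g1 t| <= C / (1 + t ^+ 2);
    profile_decay2 : forall t, `|g2 t| <= C / (1 + t ^+ 2);
    profile_even : forall t, g (- t) = g t;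
    profile_odd : forall t, g1 (- t) = - g1 t;
    profile_pos : 0 < g eps;
    profile_far : forall t, eps < `|t| -> g t < g eps;
    profile_near : forall s t, 0 <= s -> s <= t -> t <= eps ->
      beta / 2 * (t ^+ 2 - s ^+ 2) <= g s - g t;
    profile_slope : forall t, 0 <= t -> t <= eps -> g1 t <= - beta * t }.

Arguments profile_eps {R eps beta C g g1 g2}.
Arguments profile_beta {R eps beta C g g1 g2}.
Arguments profile_C {R eps beta C g g1 g2}.
Arguments profile_derive {R eps beta C g g1 g2}.
Arguments profile_derive2 {R eps beta C g g1 g2}.
Arguments profile_decay {R eps beta C g g1 g2}.
Arguments profile_decay1 {R eps beta C g g1 g2}.
Arguments profile_decay2 {R eps beta C g g1 g2}.
Arguments profile_even {R eps beta C g g1 g2}.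
Arguments profile_odd {R eps beta C g g1 g2}.
Arguments profile_pos {R eps beta C g g1 g2}.
Arguments profile_far {R eps beta C g g1 g2}.
Arguments profile_near {R eps beta C g g1 g2}.
Arguments profile_slope {R eps beta C g g1 g2}.

Lemma mvt {R : realType} (f df : R -> R) (a b : R) : a <= b ->
  (forall x, is_derive x (1 : R) f (df x)) ->
  exists2 c, a <= c <= b & f b - f a = df c * (b - a).
Proof.
move=> ab hf.
have cf : {within `[a, b], continuous f}.
  by apply: continuous_subspaceT => x; exact/differentiable_continuous/derivable1_diffP.
by have [c] := MVT_segment ab (fun x _ => hf x) cf; rewrite in_itv; exists c.
Qed.

Lemma admissible_profile {R : realType} (eps beta : R) (g : R -> R) :
  0 < eps -> 0 < beta -> admissible_kernel eps beta g ->
  exists C g1 g2, profile eps beta C g g1 g2.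
Proof.
move=> eps0 beta0 [[hder _] heven [C hC] [hpos hfar] hconc].
pose g1 := derive1n 1 g; pose g2 := derive1n 2 g.
have hd (l : nat) t : (l < 2)%N ->
    is_derive t (1 : R) (derive1n l g) (derive1n l.+1 g t).
  move=> l2; have h : derivable (derive1n l g) t 1.
    by apply: hder; apply: (ltn_trans l2).
  by apply: (DeriveDef h); exact/esym/derive1E.
have hd0 t : is_derive t (1 : R) g (g1 t) := hd 0%N t isT.
have hd1 t : is_derive t (1 : R) g1 (g2 t) := hd 1%N t isT.
(* The derivative of an even function is odd, by the chain rule for [t |-> - t]; in particular it
   vanishes at 0. *)
have odd1 t : g1 (- t) = - g1 t.
  have hN : is_derive t (1 : R) (fun x : R => - x) (- 1).
    exact: is_deriveN.
  have h := @is_derive1_comp _ g (fun x => - x) t (g1 (- t)) (- 1) (hd0 _) hN.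
  have e : g \o (fun x => - x) = g by apply/funext => x; exact: heven.
  rewrite e in h; have := @derive_val _ _ _ _ _ _ _ h.
  rewrite (@derive_val _ _ _ _ _ _ _ (hd0 t)).
  by move=> ->; rewrite mulrN1 opprK.
have g10 : g1 0 = 0 by have := odd1 0; rewrite oppr0; lra.
have slope t : 0 <= t -> t <= eps -> g1 t <= - beta * t.
  move=> t0 te; have [c /andP[c0 ct]] := mvt g1 g2 0 t t0 hd1.
  rewrite g10 !subr0 => ->; apply: ler_wpM2r => //; apply/ltW/hconc.
  by rewrite ger0_norm// (le_trans ct).
have C0 l : (l <= 3)%N -> 0 < C l by move=> /hC[].
have hdecay l t : (l < 3)%N ->
    `|derive1n l g t| <= (C 0%N + C 1%N + C 2%N) / (1 + t ^+ 2).
  move=> l3; have [_ /(_ t) h] := hC l (ltnW l3); apply: le_trans h _.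
  rewrite ler_wpM2r//; first by rewrite invr_ge0 addr_ge0// sqr_ge0.
  have := C0 0%N isT; have := C0 1%N isT; have := C0 2%N isT.
  by case: l l3 => [|[|[|]]]//; lra.
exists (C 0%N + C 1%N + C 2%N), g1, g2; split=> //.
- by have := C0 0%N isT; have := C0 1%N isT; have := C0 2%N isT; lra.
- by move=> t; exact: (hdecay 0%N).
- by move=> t; exact: (hdecay 1%N).
- by move=> t; exact: (hdecay 2%N).
- by apply: hpos; rewrite gtr0_norm.
move=> s t s0 st te.
(* On [[0, eps]] the function [g y + beta / 2 * y ^ 2] has nonpositive derivative, so it is
   nonincreasing there. *)
have hu x : is_derive x (1 : R) (fun y => g y + beta / 2 * y ^+ 2)
    (g1 x + beta * x).
  apply: is_derive_eq.
  by rewrite /= -[_ *: _]/(_ * _) -[_ *: (_ : R)]/(_ * _); lra.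
have [c /andP[sc ct]] := mvt _ _ s t st hu.
have := slope c (le_trans s0 sc) (le_trans ct te) => h.
have : (g1 c + beta * c) * (t - s) <= 0.
  by rewrite mulr_le0_ge0//; lra.
by move=> h1 h2; rewrite -h2 in h1; lra.
Qed.

(** * Gap of a correlation *)

(* The terms [psi (G (k - j))] and [psi (G k)] have the same sum over [k], so the
   gap of the correlation [Q] is a sum of Bregman divergences of [psi], which are
   nonnegative as soon as [Phi] is a subgradient of the convex function [psi]. *)
Lemma convex_gap {R : realType} (G : int -> R) (Phi psi : R -> R) (l : seq int)
    (sg : R) (j : int) :
  (forall k, G (- k) = G k) -> (forall v, psi (sg * v) = psi v) ->
  (forall k, k \notin l -> Phi (G k) = 0 /\ psi (G k) = 0) ->
  let D a b := psi b - psi a - Phi a * (b - a) in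
  let Q j := rsum [set: int] (fun k => Phi (G k) * G (j - k)) in
  ell1 (fun k => D (G k) (sg * G (k - j))) /\
  Q 0 - sg * Q j = rsum [set: int] (fun k => D (G k) (sg * G (k - j))).
Proof.
move=> Geven psisg hl D Q.
have Gsym i k : G (i - k) = G (k - i) by rewrite -Geven opprB.
have hP i : ell1 (fun k => Phi (G k) * G (i - k)).
  by apply: (ell1_finite_support l) => k /hl[-> _]; rewrite mul0r.
have hpsi : ell1 (fun k => psi (G k)).
  by apply: (ell1_finite_support l) => k /hl[].
have bij : bijective (fun k : int => k - j).
  by exists (fun k => k + j) => k; rewrite ?subrK ?addrK.
have hpsij := ell1_reindex _ _ bij hpsi.
have DE : (fun k => D (G k) (sg * G (k - j))) = (fun k => (psi (G (k - j)) -
    psi (G k)) + (Phi (G k) * G (0 - k) - sg * (Phi (G k) * G (j - k)))).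
  apply/funext => k; rewrite /D psisg (Gsym j) sub0r Geven.
  by congr (_ + _); lra.
rewrite DE; split.
  apply: ell1D; apply: ell1B => //; exact: ell1Z.
rewrite rsumD; last 2 first.
- exact: ell1B.
- by apply: ell1B => //; exact: ell1Z.
rewrite rsumB// (rsum_reindex _ (fun k => psi (G k)) bij) subrr add0r.
rewrite rsumB//; last exact: ell1Z.
by rewrite rsumZ.
Qed.

(** A subgradient of the convex function [v |-> max(|v| - th, 0)], which is [psi] in the next
    proof. *)
Definition hard_threshold {R : realType} (th v : R) : R :=
  if th < v then 1 else if v < - th then -1 else 0.

(** Convexity gives [|S j| <= S 0] for the thresholded part [S] of [Q]. The added copy of [G]
    supplies the gap [G 0 - th] as long as [|G j| <= th]; only very negative values of [G j] need a
    further argument. *)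
Lemma hard_threshold_gap {R : realType} (G : int -> R) (l : seq int) (th : R) :
  (forall k, G (- k) = G k) -> 0 < th -> th <= G 0 ->
  (forall k, k != 0 -> G k <= th) -> (forall k, k \notin l -> `|G k| <= th) ->
  let Q j := G j + rsum [set: int] (fun k => hard_threshold th (G k) * G (j - k)) in
  G 0 <= Q 0 /\ forall j, j != 0 -> `|Q j| <= Q 0 - (G 0 - th).
Proof.
move=> Geven th0 thG Gth hl Q.
pose psi (v : R) := if th < v then v - th else if v < - th then - v - th else 0.
pose D a b := psi b - psi a - hard_threshold th a * (b - a).
have D0 a b : 0 <= D a b.
  rewrite /D /psi /hard_threshold.
  by case: ltP => ?; case: ltP => ?; try case: ltP => ?; try case: ltP => ?; lra.
have hl' k : k \notin l -> hard_threshold th (G k) = 0 /\ psi (G k) = 0.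
  move=> /hl; rewrite ler_norml /hard_threshold /psi => /andP[h1 h2].
  by case: ltP => [?|_]; [lra|case: ltP => [?|//]; lra].
have psiN v : psi (-1 * v) = psi v.
  rewrite /psi; case: ltP => ?; case: ltP => ?; try case: ltP => ?; try case: ltP => ?; lra.
have psi1 v : psi (1 * v) = psi v by rewrite mul1r.
have em j : ell1 (fun k => D (G k) (1 * G (k - j))).
  by have [] := convex_gap G _ psi l 1 j Geven psi1 hl'.
have Em j := (convex_gap G _ psi l 1 j Geven psi1 hl').2.
have ep j : ell1 (fun k => D (G k) (-1 * G (k - j))).
  by have [] := convex_gap G _ psi l (-1) j Geven psiN hl'.
have Ep j := (convex_gap G _ psi l (-1) j Geven psiN hl').2.
set S := fun j => rsum [set: int] (fun k => hard_threshold th (G k) * G (j - k)).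
have Sm j : S j <= S 0.
  by have := rsum_ge0 _ (em j) (fun k => D0 _ _); rewrite -Em -!/(S _); lra.
have Sp j : 0 <= S 0 + S j.
  by have := rsum_ge0 _ (ep j) (fun k => D0 _ _); rewrite -Ep -!/(S _); lra.
have S0 : 0 <= S 0 by have := Sp 0; lra.
split; first by rewrite /Q -/(S 0); lra.
move=> j j0; rewrite /Q -!/(S _); rewrite ler_norml; apply/andP; split; last first.
  by have := Sm j; have := Gth j j0; lra.
have [Gj|Gj] := leP (- th) (G j); first by have := Sp j; lra.
(* If [G j < - th], the missing gap comes from the divergence at the index [2 j]. *)
have := ler_sum_rsum [:: j + j] _ isT (ep j) (fun k => D0 _ _).
rewrite -Ep -!/(S _) big_seq1 addrK.
have : - G j - th <= D (G (j + j)) (-1 * G j).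
  have jj : j + j != 0 by lia.
  have := Gth _ jj; rewrite /D /psi /hard_threshold; move: th0 Gj; clear => ? ? ?.
  by case: ltP => ?; case: ltP => ?; try case: ltP => ?; try case: ltP => ?; lra.
by lra.
Qed.

(** The difference between [v] and its projection onto [[- th, th]]; it is the derivative of half
    the squared distance to this interval. *)
Definition soft_threshold {R : realType} (th v : R) : R :=
  if th < v then v - th else if v < - th then v + th else 0.

(** The divergence of half the squared distance dominates half the squared difference of its
    gradients. All divergences are nonnegative, so the sum may be restricted to any finite set [s]
    of indices. *)
Lemma soft_threshold_gap {R : realType} (G : int -> R) (l s : seq int)
    (th sg : R) (j : int) :
  (forall k, G (- k) = G k) -> 0 <= th -> sg = 1 \/ sg = -1 ->
  (forall k, k \notin l -> `|G k| <= th) -> uniq s ->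
  let Q j := rsum [set: int] (fun k => soft_threshold th (G k) * G (j - k)) in
  2^-1 * (\sum_(k <- s)
    (soft_threshold th (G k) - sg * soft_threshold th (G (k - j))) ^+ 2)
  <= Q 0 - sg * Q j.
Proof.
move=> Geven th0 hsg hl us; cbv zeta.
pose psi (v : R) := 2^-1 * soft_threshold th v ^+ 2.
pose D a b := psi b - psi a - soft_threshold th a * (b - a).
have odd v : soft_threshold th (sg * v) = sg * soft_threshold th v.
  case: hsg => ->; rewrite ?mul1r// !mulN1r /soft_threshold.
  by case: ltP => ?; case: ltP => ?; try case: ltP => ?; try case: ltP => ?; lra.
have sg2 : sg ^+ 2 = 1 by case: hsg => ->; rewrite ?sqrrN expr1n.
have psisg v : psi (sg * v) = psi v by rewrite /psi odd exprMn sg2 mul1r.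
have hl' k : k \notin l -> soft_threshold th (G k) = 0 /\ psi (G k) = 0.
  move=> /hl; rewrite ler_norml /psi /soft_threshold => /andP[h1 h2].
  have [|_] := ltP th (G k); first lra.
  by have [|_] := ltP (G k) (- th); [lra|rewrite expr0n mulr0].
have [e E] := convex_gap G _ psi l sg j Geven psisg hl'.
(* The difference of the two sides is [x * ((a - x) - (b - y))], where [a - x] and [b - y] are the
   projections of [a] and [b]. If [x] is nonzero, [a - x] is the endpoint of the interval on the
   side of [x], so the product is nonnegative. *)
have DD a b : 2^-1 * (soft_threshold th a - soft_threshold th b) ^+ 2 <= D a b.
  rewrite /D /psi -subr_ge0.
  set x := soft_threshold th a; set y := soft_threshold th b.
  have -> : 2^-1 * y ^+ 2 - 2^-1 * x ^+ 2 - x * (b - a) - 2^-1 * (x - y) ^+ 2 =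
    x * ((a - x) - (b - y)) by lra.
  rewrite /x /y /soft_threshold.
  have [?|?] := ltP th a.
    by apply: mulr_ge0; first lra; case: ltP => ?; [lra|case: ltP => ?; lra].
  have [?|?] := ltP a (- th); last by rewrite mul0r.
  rewrite -mulrNN.
  by apply: mulr_ge0; first lra; case: ltP => ?; [lra|case: ltP => ?; lra].
have D0 a b : 0 <= D a b.
  by apply: le_trans (DD a b); rewrite mulr_ge0// sqr_ge0.
rewrite E; apply: le_trans (ler_sum_rsum s _ us e (fun k => D0 _ _)).
by rewrite mulr_sumr; apply: ler_sum => k _; rewrite -odd.
Qed.

(** * Finite combinations of translates *)

Definition lattice (M : nat) (l : 'I_(M.*2.+1)) : int := l%:Z - M%:Z.

Lemma lattice_inj (M : nat) : injective (@lattice M).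
Proof. by move=> i j /(congr1 (+%R^~ M%:Z)); rewrite !subrK => -[/val_inj]. Qed.

Lemma lattice_bound (M : nat) (l : 'I_(M.*2.+1)) : (absz (lattice M l) <= M)%N.
Proof. by case: l => l hl; rewrite /lattice /=; lia. Qed.

Lemma lattice_codom (M : nat) (k : int) : (absz k <= M)%N -> k \in codom (lattice M).
Proof.
move=> kM; apply/codomP; have h : (absz (k + M%:Z)%R < M.*2.+1)%N by lia.
by exists (Ordinal h); rewrite /lattice /=; lia.
Qed.

(** At a grid point [j * h] this is a discrete convolution of [w], cut off at [M], with the samples
    of [f]. Letting [t] be real allows differentiation. *)
Definition comb {R : realType} (h : R) (M : nat) (w : int -> R) (f : R -> R)
    (t : R) : R :=
  \sum_(l < M.*2.+1) w (lattice M l) * f (t - (lattice M l)%:~R * h).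

Lemma comb_rsum {R : realType} (h : R) (M : nat) (w : int -> R) (f : R -> R)
    (j : int) : (forall k, (M < absz k)%N -> w k = 0) ->
  comb h M w f (j%:~R * h) =
  rsum [set: int] (fun k => w k * f ((j - k)%:~R * h)).
Proof.
move=> hw; rewrite (rsum_finite_support (codom (lattice M))).
- by rewrite big_map big_enum; apply: eq_bigr => l _; rewrite intrB mulrBl.
- by rewrite map_inj_uniq ?enum_uniq//; exact: lattice_inj.
- move=> k hk; rewrite hw ?mul0r// ltnNge; apply: contra hk.
  exact: lattice_codom.
Qed.

(** There are [2 * M + 1] terms. When [|t| >= 2 * T], a shift by at most [T] leaves at least half of
    [|t|], which costs the factor 4. *)
Lemma comb_bound {R : realType} (h : R) (M : nat) (w : int -> R) (f : R -> R)
    (C W T : R) : 0 <= C -> (forall t, `|f t| <= C / (1 + t ^+ 2)) ->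
  (forall k, `|w k| <= W) -> 0 <= h -> 0 < T -> M%:R * h <= T ->
  let K := M.*2.+1%:R * W * (4 * C) in
  forall t, `|comb h M w f t| <= K /\
    (2 * T <= `|t| -> `|comb h M w f t| <= K / t ^+ 2).
Proof.
move=> C0 hf hw h0 T0 MT K t.
have gen (B : R) : (forall l : 'I_(M.*2.+1),
    `|f (t - (lattice M l)%:~R * h)| <= 4 * C * B) ->
    `|comb h M w f t| <= K * B.
  move=> hB; apply: le_trans (ler_norm_sum _ _ _) _.
  apply: (@le_trans _ _ (\sum_(l < M.*2.+1) W * (4 * C * B))).
    apply: ler_sum => l _; rewrite normrM; apply: ler_pM => //; exact: hB.
  by rewrite sumr_const card_ord -mulr_natl /K; lra.
have pos (x : R) : 0 < 1 + x ^+ 2 by rewrite ltr_pwDl// sqr_ge0.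
split.
  rewrite -[K]mulr1; apply: gen => l; apply: le_trans (hf _) _.
  rewrite ler_pdivrMr//; set x := _ - _.
  by have := mulr_ge0 C0 (sqr_ge0 x); lra.
move=> tT; apply: gen => l; set x := lattice M l.
have t0 : t != 0 by rewrite -normr_gt0; apply: lt_le_trans tT; lra.
apply: le_trans (hf _) _; rewrite ler_pdivrMr//.
have hx : `|x%:~R * h| <= `|t| / 2.
  rewrite normrM (ger0_norm h0) -intr_norm ler_pdivlMr//.
  apply: le_trans tT; rewrite mulrC ler_pM2l//; apply: le_trans MT.
  by rewrite ler_wpM2r// -natr_absz ler_nat lattice_bound.
have h1 : `|t| / 2 <= `|t - x%:~R * h|.
  by have := lerB_dist t (x%:~R * h); lra.
have t20 : 0 < t ^+ 2 by rewrite exprn_even_gt0.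
have h2 : t ^+ 2 <= 4 * (t - x%:~R * h) ^+ 2.
  rewrite -(real_normK (num_real t)) -(real_normK (num_real (t - _))).
  have := normr_ge0 t; move: h1; move: (`|t|) (`|_|) => y z; nra.
rewrite -subr_ge0.
have -> : 4 * C / t ^+ 2 * (1 + (t - x%:~R * h) ^+ 2) - C =
   C / t ^+ 2 * (4 + (4 * (t - x%:~R * h) ^+ 2 - t ^+ 2)).
  by move: (_ ^+ 2) (t ^+ 2) t20 => y z z0; field; rewrite gt_eqF.
apply: mulr_ge0; last by lra.
by rewrite divr_ge0// ltW.
Qed.

Lemma is_derive_comb {R : realType} (h : R) (M : nat) (w : int -> R)
    (f df : R -> R) : (forall t, is_derive t (1 : R) f (df t)) ->
  forall t, is_derive t (1 : R) (comb h M w f) (comb h M w df t).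
Proof.
move=> hf t; pose F (l : 'I_(M.*2.+1)) (x : R) : R :=
  w (lattice M l) * f (x - (lattice M l)%:~R * h).
have hF l : is_derive t (1 : R) (F l)
    (w (lattice M l) * df (t - (lattice M l)%:~R * h)).
  have e : is_derive t (1 : R) (fun x : R => x - (lattice M l)%:~R * h) 1.
    by apply: is_derive_eq; rewrite subr0.
  have := is_derive1_comp (hf _) e; rewrite mulr1 => e1.
  exact: (is_deriveZ (w (lattice M l)) e1).
have := is_derive_sum hF; rewrite /comb.
by congr (is_derive _ _ _ _); apply/funext => x; rewrite fct_sumE.
Qed.

(** For a nearest point [u i], the sum of the distances from [x] to [u i] and [u j] is at least
    [nu], and the second is the larger one. *)
Lemma nearest_point {R : realType} {I : finType} (u : I -> R) (nu x : R) :
  (forall i j, i != j -> nu <= `|u i - u j|) -> I ->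
  exists i, forall j, j != i -> nu / 2 <= `|x - u j|.
Proof.
move=> sep i0; case: (@arg_minP _ R I i0 xpredT (fun i => `|x - u i|)) => // i _ hi.
exists i => j ji; have := sep _ _ ji; have := hi j isT => /= h.
have := ler_distD x (u j) (u i); rewrite [`|u j - x|]distrC; lra.
Qed.

(** The condition [4 * T <= nu] places every [x - u i] with [D i] in the range where [F] decays
    quadratically, so [separated_tail] applies. *)
Lemma tail_sum {R : realType} {I : finType} (u a : I -> R) (F : R -> R)
    (D : pred I) (nu x A K T : R) : 0 < nu -> 4 * T <= nu -> 0 <= A -> 0 <= K ->
  (forall i j, i != j -> nu <= `|u i - u j|) ->
  (forall i, D i -> nu / 2 <= `|x - u i|) ->
  (forall i, `|a i| <= A) ->
  (forall t, 2 * T <= `|t| -> `|F t| <= K / t ^+ 2) ->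
  \sum_(i | D i) `|a i * F (x - u i)| <= A * (K * (16 / nu ^+ 2)).
Proof.
move=> nu0 nuT A0 K0 sep far ha hF.
apply: (@le_trans _ _ (\sum_(i | D i) A * (K * ((x - u i) ^+ 2)^-1))).
  apply: ler_sum => i Di; rewrite normrM; apply: ler_pM => //.
  by apply: hF; apply: le_trans (far i Di); lra.
rewrite -mulr_sumr -mulr_sumr ler_wpM2l// ler_wpM2l//.
exact: separated_tail.
Qed.

(** * Certificates on coarse grids *)

(* [h] is the grid step [1 / (sigma N)] and [Num.max h^-1 eps^-1] is the paper's
   [gamma]; the inequality on [P] and [rho] is what the constant 16 requires. *)
Definition certifiable {R : realType} (eps beta : R) (g : R -> R) (h nu : R) :
    Prop :=
  exists P rho : R,
    [/\ 0 <= P, 0 < rho,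
      2 * P <= rho * (16 * Num.max h^-1 eps^-1 ^+ 2 / beta) &
      forall (I : finType) (t : I -> int) (s : I -> R),
        (forall i j, i != j -> nu <= `|(t i)%:~R * h - (t j)%:~R * h|) ->
        (forall i, `|s i| = 1) ->
        certificate (fun k => g (k%:~R * h)) t s
          [set k | forall i, eps < `|k%:~R * h - (t i)%:~R * h|] P rho].

(** The translates are indexed by a spike and an offset. The blocks around distinct spikes are
    disjoint because [2 * (M * h) < nu]; thus no two coefficients land on the same integer, and the
    bound [P] holds position by position. *)
Lemma comb_certificate {R : realType} (g : R -> R) (h nu P rho : R) (M : nat)
    (w0 w1 : int -> R) (I : finType) (t : I -> int) (s a b : I -> R)
    (far : set int) :
  0 < h -> 2 * (M%:R * h) < nu ->
  (forall i j, i != j -> nu <= `|(t i)%:~R * h - (t j)%:~R * h|) ->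
  (forall i k, `|a i * w0 k + b i * w1 k| <= P) ->
  let q x := \sum_i (a i * comb h M w0 g (x - (t i)%:~R * h) +
                     b i * comb h M w1 g (x - (t i)%:~R * h)) in
  (forall i, q ((t i)%:~R * h) = s i) ->
  (forall k : int, `|q (k%:~R * h)| <= 1) ->
  (forall k : int, far k -> `|q (k%:~R * h)| <= 1 - rho) ->
  certificate (fun k => g (k%:~R * h)) t s far P rho.
Proof.
move=> h0 Mnu sep hP q hq hq1 hqfar.
exists (I * 'I_(M.*2.+1))%type, (fun j => t j.1 + lattice M j.2),
  (fun j => a j.1 * w0 (lattice M j.2) + b j.1 * w1 (lattice M j.2)).
move=> q'; have E k : q' k = q (k%:~R * h).
  rewrite /q' /q.
  under [RHS]eq_bigr do rewrite /comb !mulr_sumr -big_split /=.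
  rewrite [RHS]pair_bigA /=; apply: eq_bigr => -[i l] _ /=.
  have -> : k%:~R * h - (t i)%:~R * h - (lattice M l)%:~R * h =
    (k - (t i + lattice M l))%:~R * h.
    by rewrite [(k - _)%:~R]intrB [(t i + _)%:~R]intrD; lra.
  by lra.
split=> //; last 3 first.
- by move=> i; rewrite E hq.
- by move=> k; rewrite E.
- by move=> k; rewrite E; exact: hqfar.
move=> [i l] [j m] /= e; suff ij : i = j.
  by move: e; rewrite ij => /addrI/lattice_inj ->.
apply/eqP/negP => /negP /sep; apply/negP; rewrite -ltNge.
apply: le_lt_trans Mnu; have -> : (t i)%:~R * h - (t j)%:~R * h =
    (lattice M m - lattice M l)%:~R * h.
  have -> : lattice M m = t i + lattice M l - t j by rewrite e; lia.
  by rewrite [(_ - lattice M l)%:~R]intrB [(_ - t j)%:~R]intrB [(t i + _)%:~R]intrD; lra.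
rewrite normrM (gtr0_norm h0) mulrA ler_wpM2r ?(ltW h0)// -intr_norm -natr_absz.
rewrite -natrM; rewrite ler_nat; have := lattice_bound M l; have := lattice_bound M m.
by lia.
Qed.

Lemma lattice_radius {R : realType} (h T : R) : 0 < h -> 0 <= T ->
  let M := Num.truncn (T / h) in
  M%:R * h <= T /\ forall k : int, (M < absz k)%N -> T < `|k%:~R * h|.
Proof.
move=> h0 T0 M; have := @truncn_itv R (T / h); rewrite divr_ge0 ?(ltW h0)//.
move=> /(_ isT) /andP[h1 h2]; split; first by rewrite -ler_pdivlMr.
move=> k Mk; rewrite normrM (gtr0_norm h0) -ltr_pdivrMr//.
by apply: lt_le_trans h2 _; rewrite -intr_norm -natr_absz ler_nat.
Qed.

Lemma profile_radius {R : realType} (eps beta C : R) (g g1 g2 : R -> R) :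
  profile eps beta C g g1 g2 ->
  exists T : R, 0 < T /\ forall t, T < `|t| -> `|g t| <= g eps.
Proof.
move=> hg; have ge := profile_pos hg; have C0 := profile_C hg.
(* The summand 1 ensures [t ^ 2 >= |t| >= C / g eps]. *)
exists (C / g eps + 1); have CT : 0 < C / g eps by rewrite divr_gt0.
split=> [|t ht]; first by lra.
apply: le_trans (profile_decay hg t) _.
have : C / g eps <= t ^+ 2.
  have t1 : 1 <= `|t| by lra.
  by have := ler_wpM2l (normr_ge0 t) t1; rewrite -expr2 real_normK ?num_real//; lra.
rewrite ler_pdivrMr// => h; rewrite ler_pdivrMr; last first.
  by have := sqr_ge0 t; lra.
by lra.
Qed.

Lemma norm_intr_ge1 {R : realType} (k : int) : k != 0 -> 1 <= `|k%:~R : R|.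
Proof. by move=> k0; rewrite -intr_norm ler1z -gtz0_ge1 normr_gt0. Qed.

(** The system with entries [Q (u i - u j)] has diagonal [Q 0] and off-diagonal row sums at most
    [om], so its solution is bounded by [A]. At a grid point off the spikes, the nearest translate
    contributes at most [A * (Q 0 - rho)] and the others [A * om]; since [A * (Q 0 - om) = 1], the
    total is [1 - (rho - 2 * om) * A]. *)
Lemma coarse_certificate {R : realType} (g : R -> R) (h T nu K rho : R) (M : nat)
    (w : int -> R) (I : finType) (t : I -> int) (s : I -> R) :
  0 < h -> 0 < T -> 4 * T <= nu -> M%:R * h <= T -> (forall k, `|w k| <= 2) ->
  0 <= K -> 0 < rho ->
  let Q := comb h M w g in
  let om := K * (16 / nu ^+ 2) in
  let A := (Q 0 - om)^-1 in
  om <= rho / 4 -> rho < Q 0 ->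
  (forall x, 2 * T <= `|x| -> `|Q x| <= K / x ^+ 2) ->
  (forall j : int, j != 0 -> `|Q (j%:~R * h)| <= Q 0 - rho) ->
  (forall i j, i != j -> nu <= `|(t i)%:~R * h - (t j)%:~R * h|) ->
  (forall i, `|s i| = 1) ->
  certificate (fun k => g (k%:~R * h)) t s
    [set k | forall i, 0 < `|k%:~R * h - (t i)%:~R * h|]
    (2 * A) ((rho - 2 * om) * A).
Proof.
move=> h0 T0 nuT Mh w2 K0 rho0 Q om A om_le Q0 Qtail Qgap sep hs.
pose u i : R := (t i)%:~R * h.
have nu0 : 0 < nu by lra.
have om0 : 0 <= om by rewrite /om mulr_ge0 ?divr_ge0 ?sqr_ge0.
have A0 : 0 < A by rewrite invr_gt0; lra.
have AQ : A * (Q 0 - om) = 1 by rewrite mulVf//; apply/eqP; lra.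
have rhoA : 0 <= (rho - 2 * om) * A by apply: mulr_ge0; [lra|exact: ltW].
have offdiag x (D : pred I) (a : I -> R) B : 0 <= B -> (forall i, `|a i| <= B) ->
    (forall i, D i -> nu / 2 <= `|x - u i|) ->
    \sum_(i | D i) `|a i * Q (x - u i)| <= B * om.
  by move=> B0 ha far; exact: (tail_sum u a Q D nu x B K T nu0 nuT B0 K0 sep far ha Qtail).
pose m i j := Q (u i - u j).
have diag i : Q 0 <= `|m i i| by rewrite /m subrr ler_norm.
have off i : \sum_(j | j != i) `|m i j| <= om.
  rewrite -[om]mul1r; under eq_bigr do rewrite -[m _ _]mul1r.
  apply: (offdiag (u i) (fun j => j != i) (fun=> 1)) => // [_|j ji].
    by rewrite normr1.
  by rewrite eq_sym in ji; apply: le_trans (sep _ _ ji); lra.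
have omQ : om < Q 0 by lra.
have [a ha] := diag_dominant_solve m (Q 0) om s diag off omQ.
have aA i : `|a i| <= A.
  have := @diag_dominant_bound _ _ m _ _ 1 a diag off omQ; rewrite mul1r.
  by apply=> j; rewrite ha hs.
pose q x := \sum_i (a i * Q (x - u i) + (0 : R) * comb h M (fun=> 0) g (x - u i)).
have qE x : q x = \sum_i a i * Q (x - u i).
  by apply: eq_bigr => i _; rewrite mul0r addr0.
have qt i : q (u i) = s i.
  by rewrite qE -ha; apply: eq_bigr => j _; rewrite mulrC.
have qoff (k : int) : (forall i, k != t i) ->
    `|q (k%:~R * h)| <= 1 - (rho - 2 * om) * A.
  move=> kt; rewrite qE.
  (* Without spikes [q] is 0, and the claim reduces to [(rho - 2 * om) * A <= 1], which follows from
     [rho < Q 0]. *)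
  have [i0 _|I0] := pickP {: I}; last first.
    rewrite big_pred0// normr0 subr_ge0.
    by rewrite -[leRHS]AQ [_ * A]mulrC ler_wpM2l ?(ltW A0)//; lra.
  have [i hi] := nearest_point u nu (k%:~R * h) sep i0.
  have -> : 1 - (rho - 2 * om) * A = A * (Q 0 - rho) + A * om.
    by rewrite -[X in X - _]AQ; ring.
  rewrite (bigD1 i)//=; apply: le_trans (ler_normD _ _) _; apply: lerD.
    rewrite normrM; apply: ler_pM => //.
    by rewrite /u -mulrBl -intrB; apply: Qgap; rewrite subr_eq0.
  apply: le_trans (ler_norm_sum _ _ _) _.
  exact: (offdiag (k%:~R * h) (fun j => j != i) a A (ltW A0) aA hi).
apply: (comb_certificate g h nu _ _ M w (fun=> 0) I t s a (fun=> 0)) => //.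
- by lra.
- by move=> i k; rewrite mul0r addr0 normrM mulrC; apply: ler_pM.
- move=> k; have [/existsP[i /eqP ->]|/existsPn kt] := boolP [exists i, k == t i].
    by rewrite -/(u i) -/(q _) qt hs.
  by apply: le_trans (qoff k kt) _; rewrite gerBl.
- move=> k kfar; apply: qoff => i; apply/eqP => ki.
  by have := kfar i; rewrite ki subrr normr0 ltxx.
Qed.

Lemma certificate_far {R : realType} (G : int -> R) {I : finType} (t : I -> int)
    (s : I -> R) (far far' : set int) (P rho : R) :
  far' `<=` far -> certificate G t s far P rho -> certificate G t s far' P rho.
Proof.
by move=> ff [J [pos [p [? ? ? ? hq]]]]; exists J, pos, p; split=> // k /ff/hq.
Qed.

Lemma coarse_certifiable {R : realType} (eps beta C h1 : R) (g g1 g2 : R -> R) :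
  profile eps beta C g g1 g2 -> 0 < h1 ->
  exists nu0, forall nu h, nu0 <= nu -> h1 <= h -> certifiable eps beta g h nu.
Proof.
move=> hg h10; have [T [T0 hT]] := profile_radius _ _ _ _ _ _ hg.
have C0 := profile_C hg; have eps0 := profile_eps hg.
have beta0 := profile_beta hg; have geps := profile_pos hg.
(* Since [M * h <= T] and [h >= h1], the number of translates is at most [2 * (T / h1) + 1]; hence
   [K] does not depend on [h]. *)
pose K := (2 * (T / h1) + 1) * 2 * (4 * C).
pose r1 := Num.min h1 eps; pose rho1 := beta / 2 * r1 ^+ 2.
have r10 : 0 < r1 by rewrite lt_min h10.
have rho10 : 0 < rho1 by rewrite mulr_gt0 ?exprn_gt0//; lra.
have Th10 : 0 < T / h1 by rewrite divr_gt0.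
have K0 : 0 < K by rewrite /K !mulr_gt0//; lra.
(* The last summand, together with [nu <= nu ^ 2], makes the interaction [om = 16 * K / nu ^ 2] at
   most [rho1 / 4]. *)
exists (4 * T + 1 + 64 * K / rho1) => nu h hnu hh.
have h0 : 0 < h by lra.
have Kr0 : 0 < 64 * K / rho1 by rewrite divr_gt0// mulr_gt0.
have nu0 : 0 < nu by lra.
(* Here [r] is the inverse of [gamma], so [rho0] is the gap [beta / (2 * gamma ^ 2)], and [rho1]
   bounds it from below uniformly in [h]. *)
pose r := Num.min h eps; pose rho0 := beta / 2 * r ^+ 2.
have r0 : 0 < r by rewrite lt_min h0.
have rh : r <= h by rewrite ge_min lexx.
have re : r <= eps by rewrite ge_min lexx orbT.
have r1r : r1 <= r by rewrite le_min !ge_min hh lexx orbT.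
have rE : Num.max h^-1 eps^-1 = r^-1.
  rewrite /r; have [he|he] := leP h eps.
    by rewrite max_l// lef_pV2.
  by rewrite max_r// lef_pV2// ltW.
have rho0_gt : 0 < rho0 by rewrite mulr_gt0 ?exprn_gt0//; lra.
have rho1_le : rho1 <= rho0.
  by rewrite ler_wpM2l//; [lra|rewrite lerXn2r// nnegrE ltW].
pose G (k : int) := g (k%:~R * h).
have Geven k : G (- k) = G k by rewrite /G mulrNz mulNr (profile_even hg).
have G0 : G 0 = g 0 by rewrite /G mul0r.
have gabs x : g x = g `|x|.
  by case: (ger0P x) => // _; rewrite (profile_even hg).
have g0e : beta / 2 * eps ^+ 2 <= g 0 - g eps.
  have := profile_near hg 0 eps (lexx 0) (ltW eps0) (lexx eps).
  by rewrite expr0n subr0.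
have rho_e : rho0 <= g 0 - g eps.
  apply: le_trans g0e; rewrite ler_wpM2l//; first lra.
  by rewrite lerXn2r// nnegrE ltW.
pose th := g 0 - rho0.
have Gth k : k != 0 -> G k <= th.
  move=> k0; rewrite /G gabs.
  have hk : h <= `|k%:~R * h|.
    by rewrite normrM (gtr0_norm h0) ler_peMl ?(ltW h0)// norm_intr_ge1.
  have [ke|ke] := leP `|k%:~R * h| eps; last first.
    have := profile_far hg `|k%:~R * h|; rewrite normr_id => /(_ ke).
    by rewrite /th; lra.
  have := profile_near hg 0 _ (lexx 0) (normr_ge0 _) ke; rewrite expr0n subr0.
  suff : rho0 <= beta / 2 * `|k%:~R * h| ^+ 2 by rewrite /th; clear; lra.
  rewrite ler_wpM2l//; first lra.
  by rewrite lerXn2r// ?nnegrE ?normr_ge0 ?(ltW r0)// (le_trans rh).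
have [] := lattice_radius h T h0 (ltW T0).
set M := Num.truncn _ => Mh hM.
pose l := codom (lattice M).
have hl k : k \notin l -> `|G k| <= th.
  move=> kl; apply: (@le_trans _ _ (g eps)); last by rewrite /th; lra.
  apply: hT; apply: hM; rewrite ltnNge; apply: contra kl.
  exact: lattice_codom.
have [] := @hard_threshold_gap R G l th Geven _ _ Gth hl; try by rewrite ?G0 /th; lra.
pose w k : R := (k == 0)%:R + hard_threshold th (G k).
pose Q := comb h M w g.
have w0 k : (M < absz k)%N -> w k = 0.
  move=> Mk; have := hT _ (hM _ Mk); rewrite -/(G k) ler_norml => /andP[e1 e2].
  rewrite /w /hard_threshold; have -> : (k == 0) = false by apply/eqP => k0; rewrite k0 in Mk.
  have hth : g eps <= th by rewrite /th; move: rho_e; clear; lra.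
  by rewrite add0r ltNge (le_trans e2 hth) /= ltNge (le_trans _ e1)// lerN2.
have QE j : Q (j%:~R * h) = G j +
    rsum [set: int] (fun k => hard_threshold th (G k) * G (j - k)).
  rewrite /Q comb_rsum// /w.
  have -> : (fun k => ((k == 0)%:R + hard_threshold th (G k)) *
      g ((j - k)%:~R * h)) = (fun k => (k == 0)%:R * G (j - k) +
      hard_threshold th (G k) * G (j - k)).
    by apply/funext => k; rewrite mulrDl.
  rewrite rsumD.
  - rewrite (rsum_finite_support [:: 0])//; first by rewrite big_seq1 eqxx mul1r subr0.
    by move=> k; rewrite inE => /negPf ->; rewrite mul0r.
  - apply: (ell1_finite_support [:: 0]).
    by move=> k; rewrite inE => /negPf ->; rewrite mul0r.
  - apply: (ell1_finite_support l) => k /hl; rewrite ler_norml => /andP[e1 e2].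
    by rewrite /hard_threshold ltNge e2 /= ltNge e1 mul0r.
rewrite -QE mul0r => Q0G Qgap.
have {}Qgap (j : int) : j != 0 -> `|Q (j%:~R * h)| <= Q 0 - rho0.
  by move=> /Qgap; rewrite -QE G0 /th; lra.
have w2 k : `|w k| <= 2.
  apply: le_trans (ler_normD _ _) _; rewrite normr_nat /hard_threshold.
  have : (k == 0)%:R <= 1 :> R by case: (k == 0); rewrite ?lexx ?ler01.
  move=> k1; rewrite -[2]/(1 + 1 : R) lerD//.
  by case: ltP => _; [|case: ltP => _]; rewrite ?normrN ?normr1 ?normr0.
have KM : M.*2.+1%:R * 2 * (4 * C) <= K.
  rewrite ler_wpM2r//; first lra.
  rewrite ler_wpM2r// -natr1 -muln2 natrM mulrC lerD2r ler_wpM2l//.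
  rewrite ler_pdivlMr//; apply: le_trans Mh; rewrite ler_wpM2l//.
have Qtail x : 2 * T <= `|x| -> `|Q x| <= K / x ^+ 2.
  move=> /(comb_bound h M w g C 2 T (ltW C0) (profile_decay hg) w2 (ltW h0) T0 Mh x).2.
  by move=> /le_trans; apply; rewrite ler_wpM2r// invr_ge0 sqr_ge0.
move: Q0G; rewrite G0 => Q0G.
pose om := K * (16 / nu ^+ 2).
have om_le : om <= rho0 / 4.
  apply: (@le_trans _ _ (rho1 / 4)); last by rewrite ler_wpM2r.
  rewrite /om mulrA ler_pdivrMr ?exprn_gt0//.
  have : 64 * K / rho1 <= nu ^+ 2.
    have nu1 : 1 <= nu by move: hnu T0 Kr0; clear; lra.
    by apply: le_trans (ler_peMl (ltW nu0) nu1); move: hnu T0; clear; lra.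
  by rewrite ler_pdivrMr//; clear; lra.
have om0 : 0 <= om by rewrite /om mulr_ge0 ?divr_ge0 ?sqr_ge0 ?ltW.
have Q0 : rho0 < Q 0 by move: rho_e geps Q0G; clear; lra.
pose A := (Q 0 - om)^-1.
have A0 : 0 < A by rewrite invr_gt0; move: Q0 om_le rho0_gt; clear; lra.
exists (2 * A), ((rho0 - 2 * om) * A); split=> //.
- by rewrite mulr_ge0// ltW.
- by rewrite mulr_gt0//; move: om_le rho0_gt; clear; lra.
(* Origin of the constant 16: [16 * gamma ^ 2 / beta] equals [8 / rho0], while [om <= rho0 / 4]
   leaves at least [rho0 / 2 * A] for [rho], and [2 * P = 4 * A]. *)
- rewrite rE; have -> : 16 * r^-1 ^+ 2 / beta = 8 / rho0.
    by rewrite /rho0; field; rewrite !gt_eqF.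
  have -> : 2 * (2 * A) = rho0 / 2 * A * (8 / rho0).
    by field; rewrite gt_eqF.
  by rewrite ler_pM2r ?divr_gt0// ler_pM2r//; move: om_le; clear; lra.
move=> I t s sep hs.
apply: (certificate_far _ _ _ [set k | forall i, 0 < `|k%:~R * h - (t i)%:~R * h|]).
  by move=> k + i => /(_ i); exact: lt_trans.
apply: (coarse_certificate g h T nu K rho0 M w) => //; last exact: ltW.
by move: hnu Kr0; clear; lra.
Qed.

(** * Interpolation with vanishing derivatives *)

Lemma is_derive_bigsum {R : realType} {J : Type} (s : seq J) (F dF : J -> R -> R)
    (x : R) : (forall j, is_derive x (1 : R) (F j) (dF j x)) ->
  is_derive x (1 : R) (fun y => \sum_(j <- s) F j y) (\sum_(j <- s) dF j x).
Proof.
move=> hF; elim: s => [|j s IH].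
  have -> : (fun y => \sum_(j <- [::]) F j y) = cst 0.
    by apply/funext => y; rewrite big_nil.
  by rewrite big_nil; exact: is_derive_cst.
have -> : (fun y => \sum_(i <- j :: s) F i y) =
    F j + (fun y => \sum_(i <- s) F i y).
  by apply/funext => y; rewrite big_cons.
by rewrite big_cons; exact: is_deriveD.
Qed.

Lemma is_derive_shift {R : realType} (F dF : R -> R) (c x v : R) :
  (forall y, is_derive y (1 : R) F (dF y)) ->
  is_derive x (1 : R) (fun y => c * F (y - v)) (c * dF (x - v)).
Proof.
move=> hF; have e : is_derive x (1 : R) (fun y : R => y - v) 1.
  by apply: is_derive_eq; rewrite subr0.
have := is_derive1_comp (hF _) e; rewrite mulr1 => e1.
exact: (is_deriveZ c e1).
Qed.

(** The mean value theorem is applied twice, first to [F] and then to [F1], whose value at [u] is 0;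
    the factor one half of Taylor's formula is given up. *)
Lemma quadratic_error {R : realType} (F F1 F2 : R -> R) (kap x u : R) :
  (forall y, is_derive y (1 : R) F (F1 y)) ->
  (forall y, is_derive y (1 : R) F1 (F2 y)) -> F1 u = 0 ->
  (forall y, `|y - u| <= `|x - u| -> `|F2 y| <= kap) ->
  `|F x - F u| <= kap * (x - u) ^+ 2.
Proof.
move=> h1 h2 F1u hk.
have mvt' (f df : R -> R) (y : R) : (forall z, is_derive z (1 : R) f (df z)) ->
    exists2 c, `|c - u| <= `|y - u| & f y - f u = df c * (y - u).
  move=> hf; have [uy|yu] := leP u y.
    have [c /andP[uc cy] e] := mvt f df u y uy hf; exists c => //.
    by rewrite !ger0_norm ?subr_ge0//; lra.
  have [c /andP[yc cu] e] := mvt f df y u (ltW yu) hf; exists c.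
    by rewrite !ler0_norm ?subr_le0 ?(ltW yu)//; lra.
  by rewrite -[LHS]opprB e; lra.
have [c cx ->] := mvt' F F1 x h1; have [e ec] := mvt' F1 F2 c h2.
rewrite F1u subr0 => ->.
rewrite !normrM -[(x - u) ^+ 2]real_normK ?num_real// expr2 mulrA.
by rewrite ler_wpM2r// ler_pM// hk// (le_trans ec).
Qed.

Definition decays {R : realType} (K T : R) (F : R -> R) : Prop :=
  forall t, `|F t| <= K /\ (2 * T <= `|t| -> `|F t| <= K / t ^+ 2).

Lemma decays_tail {R : realType} {I : finType} (u a b : I -> R) (F H : R -> R)
    (D : pred I) (nu x M K T : R) : 0 < nu -> 4 * T <= nu -> 0 <= M -> 0 <= K ->
  decays K T F -> decays K T H ->
  (forall i j, i != j -> nu <= `|u i - u j|) ->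
  (forall i, D i -> nu / 2 <= `|x - u i|) ->
  (forall i, `|a i| <= M) -> (forall i, `|b i| <= M) ->
  \sum_(i | D i) (`|a i * F (x - u i)| + `|b i * H (x - u i)|)
    <= M * (2 * (K * (16 / nu ^+ 2))).
Proof.
move=> nu0 nuT M0 K0 hF hH sep far ha hb; rewrite big_split /=.
have := tail_sum u a F D nu x M K T nu0 nuT M0 K0 sep far ha (fun t => (hF t).2).
have := tail_sum u b H D nu x M K T nu0 nuT M0 K0 sep far hb (fun t => (hH t).2).
by lra.
Qed.

(** Hermite interpolation with values [s] and zero derivatives. The unknowns are indexed by [I + I].
    Because [Q1 0 = V 0 = 0], the two blocks do not interact at a common spike: the diagonal is at
    least [d], and the off-diagonal row sums consist of tails only. *)
Lemma interpolation_system {R : realType} {I : finType} (u s : I -> R)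
    (Q Q1 V V1 : R -> R) (nu K T d : R) :
  0 < nu -> 4 * T <= nu -> 0 <= K -> 0 < d ->
  decays K T Q -> decays K T Q1 -> decays K T V -> decays K T V1 ->
  Q1 0 = 0 -> V 0 = 0 -> d <= Q 0 -> d <= V1 0 ->
  2 * (K * (16 / nu ^+ 2)) <= d / 2 ->
  (forall i j, i != j -> nu <= `|u i - u j|) -> (forall i, `|s i| = 1) ->
  exists a b : I -> R, [/\ forall i, `|a i| <= 2 / d, forall i, `|b i| <= 2 / d,
    forall i, \sum_j (a j * Q (u i - u j) + b j * V (u i - u j)) = s i &
    forall i, \sum_j (a j * Q1 (u i - u j) + b j * V1 (u i - u j)) = 0].
Proof.
move=> nu0 nuT K0 d0 hQ hQ1 hV hV1 Q10 V00 Qd Vd; set eta := 2 * _ => eta_le sep hs.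
pose m (x y : I + I) : R := match x, y with
  | inl i, inl j => Q (u i - u j) | inl i, inr j => V (u i - u j)
  | inr i, inl j => Q1 (u i - u j) | inr i, inr j => V1 (u i - u j) end.
pose rhs (x : I + I) : R := if x is inl i then s i else 0.
have diag x : d <= `|m x x|.
  by case: x => i /=; rewrite subrr; apply: le_trans (ler_norm _).
have off x : \sum_(y | y != x) `|m x y| <= eta.
  have tail F H i : decays K T F -> decays K T H ->
      \sum_(j | j != i) (`|F (u i - u j)| + `|H (u i - u j)|) <= eta.
    move=> hF hH.
    have far j : j != i -> nu / 2 <= `|u i - u j|.
      by rewrite eq_sym => /sep; lra.
    have := decays_tail u (fun=> 1) (fun=> 1) F H (fun j => j != i) nu (u i) 1 K T
      nu0 nuT ler01 K0 hF hH sep far.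
    rewrite normr1 mul1r => /(_ (fun=> lexx _) (fun=> lexx _)).
    by under eq_bigr do rewrite !mul1r.
  rewrite big_sumType /=; case: x => i /=.
    apply: le_trans (tail Q V i hQ hV); rewrite big_split /= lerD//.
    rewrite (bigD1 i)//= subrr V00 normr0 add0r.
    by rewrite le_eqVlt; apply/orP; left; apply/eqP; apply: eq_bigl.
  apply: le_trans (tail Q1 V1 i hQ1 hV1); rewrite big_split /= lerD//.
  rewrite (bigD1 i)//= subrr Q10 normr0 add0r.
  by rewrite le_eqVlt; apply/orP; left; apply/eqP; apply: eq_bigl.
have etad : eta < d by lra.
have [c hc] := diag_dominant_solve m d eta rhs diag off etad.
have cM x : `|c x| <= 2 / d.
  have hB y : `|\sum_z m y z * c z| <= 1.
    by rewrite hc; case: y => i /=; rewrite ?hs ?normr0.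
  apply: le_trans (diag_dominant_bound m d eta 1 c diag off etad hB x) _.
  by rewrite div1r -[2 / d]invf_div lef_pV2 ?posrE ?divr_gt0//; lra.
exists (fun i => c (inl i)), (fun i => c (inr i)); split=> // i.
  rewrite -[RHS](hc (inl i)) big_sumType big_split /=.
  by congr (_ + _); apply: eq_bigr => j _; rewrite mulrC.
rewrite -[RHS](hc (inr i)) big_sumType big_split /=.
by congr (_ + _); apply: eq_bigr => j _; rewrite mulrC.
Qed.

(** Isolates the spike [i] in its own two equations: up to tails they read [a i * Q 0 = s i] and
    [b i * V1 0 = 0]. *)
Lemma interpolation_coef {R : realType} {I : finType} (u a b s : I -> R)
    (Q Q1 V V1 : R -> R) (nu K T d : R) (i : I) :
  0 < nu -> 4 * T <= nu -> 0 <= K -> 0 < d ->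
  decays K T Q -> decays K T Q1 -> decays K T V -> decays K T V1 ->
  Q1 0 = 0 -> V 0 = 0 -> d <= V1 0 ->
  (forall i j, i != j -> nu <= `|u i - u j|) ->
  (forall i, `|a i| <= 2 / d) -> (forall i, `|b i| <= 2 / d) ->
  \sum_j (a j * Q (u i - u j) + b j * V (u i - u j)) = s i ->
  \sum_j (a j * Q1 (u i - u j) + b j * V1 (u i - u j)) = 0 ->
  let e := 2 / d * (2 * (K * (16 / nu ^+ 2))) in
  `|a i * Q 0 - s i| <= e /\ `|b i| <= e / d.
Proof.
move=> nu0 nuT K0 d0 hQ hQ1 hV hV1 Q10 V00 Vd sep ha hb hq hq1 e.
have far j : j != i -> nu / 2 <= `|u i - u j|.
  by rewrite eq_sym => /sep; lra.
have M0 : 0 <= 2 / d by rewrite divr_ge0// ltW.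
have tail F H : decays K T F -> decays K T H ->
    `|\sum_(j | j != i) (a j * F (u i - u j) + b j * H (u i - u j))| <= e.
  move=> hF hH; apply: le_trans (ler_norm_sum _ _ _) _.
  apply: le_trans (decays_tail u a b F H (fun j => j != i) nu (u i) (2 / d) K T
    nu0 nuT M0 K0 hF hH sep far ha hb).
  by apply: ler_sum => j _; exact: ler_normD.
split.
  rewrite -hq (bigD1 i)//= subrr V00 mulr0 addr0 opprD addrA subrr sub0r normrN.
  exact: tail.
move: hq1; rewrite (bigD1 i)//= subrr Q10 mulr0 add0r => /eqP.
rewrite addr_eq0 => /eqP hb1.
rewrite ler_pdivlMr//; apply: le_trans (tail Q1 V1 hQ1 hV1).
have <- : `|b i * V1 0| = `|\sum_(j | j != i) (a j * Q1 (u i - u j) +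
    b j * V1 (u i - u j))| by rewrite hb1 normrN.
by rewrite normrM ler_wpM2l//; apply: le_trans (ler_norm _).
Qed.

(** Near the spike [i] everything except [a i * F] is small: the coefficient [b i] is at most
    [e / d], and the other spikes contribute a tail. *)
Lemma remainder_bound {R : realType} {I : finType} (u a b : I -> R)
    (F H : R -> R) (nu K T d y : R) (i : I) :
  0 < nu -> 4 * T <= nu -> 0 <= K -> 0 < d -> decays K T F -> decays K T H ->
  (forall i j, i != j -> nu <= `|u i - u j|) ->
  (forall i, `|a i| <= 2 / d) -> (forall i, `|b i| <= 2 / d) ->
  (forall j, j != i -> nu / 2 <= `|y - u j|) ->
  let e := 2 / d * (2 * (K * (16 / nu ^+ 2))) in
  `|b i| <= e / d ->
  `|\sum_j (a j * F (y - u j) + b j * H (y - u j)) - a i * F (y - u i)|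
    <= e * (K / d + 1).
Proof.
move=> nu0 nuT K0 d0 hF hH sep ha hb far e hbi.
have M0 : 0 <= 2 / d by rewrite divr_ge0// ltW.
rewrite (bigD1 i)//=.
have -> (A B C : R) : A + B + C - A = B + C by ring.
apply: le_trans (ler_normD _ _) _; rewrite mulrDr mulr1; apply: lerD.
  have -> : e * (K / d) = e / d * K by ring.
  by rewrite normrM ler_pM//; exact: (hH _).1.
apply: le_trans (ler_norm_sum _ _ _) _.
apply: le_trans (decays_tail u a b F H (fun j => j != i) nu y (2 / d) K T
  nu0 nuT M0 K0 hF hH sep far ha hb).
by apply: ler_sum => j _; exact: ler_normD.
Qed.

(** The derivative of [r] vanishes at [u i], since both the whole combination and [Q] have zero
    derivative there. Its second derivative is bounded by [remainder_bound]; [2 * eps <= nu] keeps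
    the other spikes at distance at least [nu / 2]. *)
Lemma remainder_quadratic {R : realType} {I : finType} (u a b : I -> R)
    (Q Q1 Q2 V V1 V2 : R -> R) (nu K T d eps x : R) (i : I) :
  0 < nu -> 4 * T <= nu -> 2 * eps <= nu -> 0 <= K -> 0 < d ->
  (forall y, is_derive y (1 : R) Q (Q1 y)) ->
  (forall y, is_derive y (1 : R) Q1 (Q2 y)) ->
  (forall y, is_derive y (1 : R) V (V1 y)) ->
  (forall y, is_derive y (1 : R) V1 (V2 y)) ->
  decays K T Q2 -> decays K T V2 -> Q1 0 = 0 ->
  (forall i j, i != j -> nu <= `|u i - u j|) ->
  (forall i, `|a i| <= 2 / d) -> (forall i, `|b i| <= 2 / d) ->
  \sum_j (a j * Q1 (u i - u j) + b j * V1 (u i - u j)) = 0 ->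
  `|x - u i| <= eps ->
  let e := 2 / d * (2 * (K * (16 / nu ^+ 2))) in
  `|b i| <= e / d ->
  let r y := \sum_j (a j * Q (y - u j) + b j * V (y - u j)) - a i * Q (y - u i) in
  `|r x - r (u i)| <= e * (K / d + 1) * (x - u i) ^+ 2.
Proof.
move=> nu0 nuT nue K0 d0 dQ dQ1 dV dV1 hQ2 hV2 Q10 sep ha hb hq1 xe e hbi; cbv zeta.
pose r y := \sum_j (a j * Q (y - u j) + b j * V (y - u j)) - a i * Q (y - u i).
rewrite -/(r x) -/(r (u i)).
pose rem (F H : R -> R) y :=
  \sum_j (a j * F (y - u j) + b j * H (y - u j)) - a i * F (y - u i).
have drem F F1 H H1 : (forall y, is_derive y (1 : R) F (F1 y)) ->
    (forall y, is_derive y (1 : R) H (H1 y)) ->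
    forall y, is_derive y (1 : R) (rem F H) (rem F1 H1 y).
  move=> hF hH y; apply: (is_deriveB _ (is_derive_shift _ _ (a i) y (u i) hF)).
  apply: (is_derive_bigsum _ _ (fun j z => a j * F1 (z - u j) + b j * H1 (z - u j))).
  move=> j; exact: (is_deriveD (is_derive_shift _ _ (a j) y (u j) hF)
    (is_derive_shift _ _ (b j) y (u j) hH)).
apply: (quadratic_error r (rem Q1 V1) (rem Q2 V2) _ _ _
  (drem _ _ _ _ dQ dV) (drem _ _ _ _ dQ1 dV1)).
  by rewrite /rem hq1 subrr Q10 mulr0 subr0.
move=> y yx; apply: (remainder_bound u a b Q2 V2 nu K T d y i) => // j ji.
rewrite eq_sym in ji; have := sep _ _ ji; have := ler_distD y (u i) (u j).
by rewrite [`|u i - y|]distrC; lra.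
Qed.

Lemma norm_unit_mul {R : realType} (s q : R) : `|s| = 1 -> `|q| = `|s * q|.
Proof. by move=> hs; rewrite normrM hs mul1r. Qed.

(** Around a spike the interpolant is a multiple of a translate of the even combination plus a small
    remainder. The gap [c] absorbs the remainder away from the spike, and the quadratic decrease
    absorbs it close to the spike. *)
Lemma fine_certificate {R : realType} (g g1 g2 : R -> R)
    (h T nu K d c eps P : R) (M : nat) (w0 w1 : int -> R) (I : finType)
    (t : I -> int) (s : I -> R) :
  (forall y, is_derive y (1 : R) g (g1 y)) ->
  (forall y, is_derive y (1 : R) g1 (g2 y)) ->
  0 < h -> 0 < T -> 0 < K -> 0 < d -> 0 < c -> 0 < eps ->
  4 * T <= nu -> 2 * eps <= nu -> M%:R * h <= T ->
  decays K T (comb h M w0 g) -> decays K T (comb h M w0 g1) ->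
  decays K T (comb h M w0 g2) -> decays K T (comb h M w1 g) ->
  decays K T (comb h M w1 g1) -> decays K T (comb h M w1 g2) ->
  comb h M w0 g1 0 = 0 -> comb h M w1 g 0 = 0 ->
  d <= comb h M w0 g 0 -> d <= comb h M w1 g1 0 ->
  (forall j : int, `|j%:~R * h| <= eps ->
    comb h M w0 g (j%:~R * h) <= comb h M w0 g 0 - c * (j%:~R * h) ^+ 2) ->
  (forall j : int, eps < `|j%:~R * h| ->
    comb h M w0 g (j%:~R * h) <= comb h M w0 g 0 - c) ->
  (forall j : int, - (comb h M w0 g 0 - c) <= comb h M w0 g (j%:~R * h)) ->
  2 / d * (2 * (K * (16 / nu ^+ 2))) * (2 + K / d) <= c / (8 * K) ->
  (forall k, 2 / d * (`|w0 k| + `|w1 k|) <= P) ->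
  (forall i j, i != j -> nu <= `|(t i)%:~R * h - (t j)%:~R * h|) ->
  (forall i, `|s i| = 1) ->
  certificate (fun k => g (k%:~R * h)) t s
    [set k | forall i, eps < `|k%:~R * h - (t i)%:~R * h|] P (c / (2 * K)).
Proof.
move=> dg dg1 h0 T0 K0 d0 c0 eps0 nuT nue Mh hQ hQ1 hQ2 hV hV1 hV2 Q10 V00 Qd Vd.
have dQ := is_derive_comb h M w0 _ _ dg; have dQ1 := is_derive_comb h M w0 _ _ dg1.
have dV := is_derive_comb h M w1 _ _ dg; have dV1 := is_derive_comb h M w1 _ _ dg1.
move: hQ hQ1 hQ2 hV hV1 hV2 Q10 V00 Qd Vd dQ dQ1 dV dV1.
have [Q QE] : {Q | Q = comb h M w0 g} by exists (comb h M w0 g).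
have [Q1 Q1E] : {Q | Q = comb h M w0 g1} by exists (comb h M w0 g1).
have [Q2 Q2E] : {Q | Q = comb h M w0 g2} by exists (comb h M w0 g2).
have [V VE] : {Q | Q = comb h M w1 g} by exists (comb h M w1 g).
have [V1 V1E] : {Q | Q = comb h M w1 g1} by exists (comb h M w1 g1).
have [V2 V2E] : {Q | Q = comb h M w1 g2} by exists (comb h M w1 g2).
rewrite -QE -Q1E -Q2E -VE -V1E -V2E.
move=> hQ hQ1 hQ2 hV hV1 hV2 Q10 V00 Qd Vd dQ dQ1 dV dV1 near far plus.
set eta := 2 * (K * _); set e := 2 / d * eta => small hP sep hs.
pose u i : R := (t i)%:~R * h.
have nu0 : 0 < nu by lra.
have K0' := ltW K0.
have eta0 : 0 <= eta by rewrite /eta mulr_ge0// mulr_ge0// divr_ge0// sqr_ge0.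
have e0 : 0 <= e by rewrite /e mulr_ge0// divr_ge0// ltW.
have QK : Q 0 <= K by apply: le_trans (ler_norm _) (hQ 0).1.
have cK : c <= 2 * K by have := plus 0; rewrite mul0r; lra.
have cK1 : c / (2 * K) <= 1 by rewrite ler_pdivrMr ?mul1r// mulr_gt0.
have Kd0 : 0 < K / d by rewrite divr_gt0.
pose kap := e * (K / d + 1).
have kap0 : 0 <= kap by rewrite mulr_ge0// addr_ge0// ltW.
have rho_eq : c / (2 * K) = 4 * (c / (8 * K)) by field; rewrite gt_eqF.
(* The factor [2 + K / d] in the smallness assumption is exactly [(e + kap) / e]. *)
have ekap : e + kap <= c / (8 * K) by apply: le_trans small; rewrite /kap; lra.
have e8 : 8 * e <= 1.
  have : 0 <= e * (K / d) by rewrite mulr_ge0// ltW.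
  by move: small cK1; rewrite rho_eq; clear; lra.
have e2 : 2 * e <= 1 by move: e0 e8; clear; lra.
have eta_le : eta <= d / 2.
  have : 2 * e = eta / (d / 4) by rewrite /e; field; rewrite gt_eqF.
  move=> e2E; move: e2; rewrite e2E ler_pdivrMr; last by rewrite divr_gt0.
  by rewrite mul1r; move: d0; clear; lra.
have [a [b [ha hb hq hq1]]] := interpolation_system u s Q Q1 V V1 nu K T d nu0 nuT
  K0' d0 hQ hQ1 hV hV1 Q10 V00 Qd Vd eta_le sep hs.
have coef i := interpolation_coef u a b s Q Q1 V V1 nu K T d i nu0 nuT
  K0' d0 hQ hQ1 hV hV1 Q10 V00 Vd sep ha hb (hq i) (hq1 i).
pose q x := \sum_j (a j * Q (x - u j) + b j * V (x - u j)).
have Q0 : 0 < Q 0 := lt_le_trans d0 Qd.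
have alpha i : 1 - e <= s i * a i * Q 0 <= 1 + e.
  have [h1 _] := coef i; have ss : s i * s i = 1.
    by rewrite -expr2 -real_normK ?num_real// hs expr1n.
  have : `|s i * (a i * Q 0 - s i)| <= e by rewrite normrM hs mul1r.
  rewrite mulrBr ss mulrA ler_norml => /andP[].
  by clear=> h2 h3; apply/andP; split; lra.
(* In units of [c / (8 * K)]: from [e <= 1 / 8] and [Q 0 <= K] the right side is at least 7, while
   [e + kap] is at most 1 and [c / (2 * K)] is 4. *)
have alphac i : e + kap + c / (2 * K) <= s i * a i * c.
  apply: (@le_trans _ _ (7 * (c / (8 * K)))); first by rewrite rho_eq; move: ekap e0 kap0; clear; lra.
  have /andP[h1 _] := alpha i.
  have a0 : 0 <= s i * a i by rewrite -(pmulr_lge0 _ Q0); move: h1 e2 e0; clear; lra.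
  have h2 : s i * a i * Q 0 <= s i * a i * K by rewrite ler_wpM2l.
  rewrite mulrA ler_pdivrMr ?mulr_gt0//.
  have : 7 <= s i * a i * (8 * K) by move: h1 h2 e8; clear; lra.
  by move=> /(ler_wpM2r (ltW c0)); clear; lra.
have locate (k : int) (i : I) : (forall j, j != i -> nu / 2 <= `|k%:~R * h - u j|) ->
    let y := (k - t i)%:~R * h in
    [/\ -1 <= s i * q (k%:~R * h), s i * q (k%:~R * h) <= 1 &
      eps < `|y| -> `|q (k%:~R * h)| <= 1 - c / (2 * K)].
  move=> hfar y; have [_ hbi] := coef i.
  have yE : y = k%:~R * h - u i by rewrite /y intrB mulrBl.
  pose rem x := q x - a i * Q (x - u i).
  have hrem : `|rem (k%:~R * h)| <= kap.
    exact: (remainder_bound u a b Q V nu K T d _ i nu0 nuT K0' d0 hQ hV sep ha hb hfar).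
  have := hrem; rewrite (norm_unit_mul (s i))// ler_norml => /andP[hr1 hr2].
  have qE : s i * q (k%:~R * h) = s i * a i * Q y + s i * rem (k%:~R * h).
    by rewrite /rem -yE; ring.
  have /andP[al1 al2] := alpha i; have alc := alphac i.
  have a0 : 0 <= s i * a i by rewrite -(pmulr_lge0 _ Q0); move: al1 e2 e0; clear; lra.
  have lower : -1 + c / (2 * K) <= s i * q (k%:~R * h).
    have := ler_wpM2l a0 (plus (k - t i)); rewrite -/y qE.
    by move: hr1 al2 alc; clear; lra.
  have faru : eps < `|y| -> s i * q (k%:~R * h) <= 1 - c / (2 * K).
    move=> /far h1; have := ler_wpM2l a0 h1; rewrite -/y qE.
    by move: hr2 al2 alc; clear; lra.
  have rho0 : 0 <= c / (2 * K) by rewrite divr_ge0 ?ltW// mulr_gt0.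
  split.
  - by apply: le_trans lower; rewrite lerDl.
  (* Within [eps] of the spike a constant bound on the remainder is too weak. The comparison is with
     the exact value at the spike, and both variations are quadratic in [y]. *)
  - have [ye|/faru h1] := leP `|y| eps; last by apply: le_trans h1 _; rewrite gerBl.
    have := ye; rewrite yE => yeu.
    have := remainder_quadratic u a b Q Q1 Q2 V V1 V2 nu K T d eps _ i nu0 nuT nue
      K0' d0 dQ dQ1 dV dV1 hQ2 hV2 Q10 sep ha hb (hq1 i) yeu hbi.
    lazy zeta beta; rewrite -/(q _) -/(q (u i)) -/(rem (k%:~R * h)) -/(rem (u i)) -/kap -yE.
    rewrite (norm_unit_mul (s i))// ler_norml mulrBr => /andP[_ h1].
    have h2 := ler_wpM2l a0 (near _ ye).
    have h3 : s i * a i * Q 0 + s i * rem (u i) = 1.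
      have -> : s i * a i * Q 0 + s i * rem (u i) = s i * q (u i).
        by rewrite /rem subrr; ring.
      by rewrite /q hq -expr2 -real_normK ?num_real// hs expr1n.
    have h4 : kap * y ^+ 2 <= s i * a i * c * y ^+ 2.
      by rewrite ler_wpM2r ?sqr_ge0//; move: alc e0 rho0; clear; lra.
    by move: h1 h2 h3 h4; rewrite qE -/y; clear; lra.
  - move=> yeps; rewrite (norm_unit_mul (s i))// ler_norml faru// andbT.
    by rewrite opprB addrC.
have qt i : q (u i) = s i := hq i.
have cK0 : 0 < c / (2 * K) by rewrite divr_gt0// mulr_gt0.
apply: (comb_certificate g h nu _ _ M w0 w1 I t s a b) => //.
- by move: Mh nuT T0; clear; lra.
- move=> i k; apply: le_trans (ler_normD _ _) _; rewrite !normrM.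
  by apply: le_trans (hP k); rewrite mulrDr lerD// ler_wpM2r.
- by rewrite -QE -VE.
- rewrite -QE -VE => k; rewrite -/(q _).
  have [i0 _|I0] := pickP {: I}; last by rewrite /q big_pred0// normr0.
  have [i hi] := nearest_point u nu (k%:~R * h) sep i0.
  have [h1 h2 _] := locate k i hi.
  by rewrite (norm_unit_mul (s i))// ler_norml h1.
- rewrite -QE -VE => k kfar; rewrite -/(q _).
  have [i0 _|I0] := pickP {: I}; last by rewrite /q big_pred0// normr0 subr_ge0.
  have [i hi] := nearest_point u nu (k%:~R * h) sep i0.
  have [_ _ ->//] := locate k i hi.
  by rewrite intrB mulrBl; exact: kfar.
Qed.

(** * Correlation with the peak of the kernel *)

Lemma rsum_odd {R : realType} (f : int -> R) : ell1 f ->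
  (forall k, f (- k) = - f k) -> rsum [set: int] f = 0.
Proof.
move=> hf fodd; have bij : bijective (fun k : int => - k).
  by exists (fun k => - k) => k; rewrite opprK.
have := rsum_reindex _ f bij.
under [X in rsum _ X]funext do rewrite fodd.
by rewrite rsumN// => h; lra.
Qed.

(** Grid points in [[eps / 4, eps / 2]], weighted by [h], have mass at least [eps / 8]. This is what
    makes the gap of the Riemann sum independent of [h]. *)
Lemma lattice_count {R : realType} (eps h : R) : 0 < h -> 0 < eps ->
  h <= eps / 8 ->
  exists l : seq int, [/\ uniq l, eps / 8 <= (size l)%:R * h &
    {in l, forall k : int, eps / 4 <= k%:~R * h <= eps / 2}].
Proof.
move=> h0 eps0 he; pose m := Num.truncn (eps / 4 / h).
pose n := Num.truncn (eps / 8 / h).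
have := @truncn_itv R (eps / 4 / h); rewrite divr_ge0 ?divr_ge0 ?(ltW eps0) ?(ltW h0)//.
move=> /(_ isT); rewrite -/m => /andP[m1 m2].
have := @truncn_itv R (eps / 8 / h); rewrite divr_ge0 ?divr_ge0 ?(ltW eps0) ?(ltW h0)//.
move=> /(_ isT); rewrite -/n => /andP[n1 n2].
move: m1 m2 n1 n2; rewrite !ler_pdivlMr// !ltr_pdivrMr// => m1 m2 n1 n2.
(* The first point exceeds [eps / 4] by at most [h], and the following ones extend over at most
   [eps / 8], so [h <= eps / 8] keeps them all below [eps / 2]. *)
exists [seq Posz i | i <- iota m.+1 n.+1]; split.
- by rewrite map_inj_uniq ?iota_uniq// => i j [].
- by rewrite size_map size_iota; lra.
move=> k /mapP[i]; rewrite mem_iota => /andP[mi im] ->.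
have i1 : m.+1%:R * h <= i%:R * h by rewrite ler_wpM2r ?(ltW h0)// ler_nat.
have i2 : i%:R * h <= (m.+1 + n)%:R * h.
  by rewrite ler_wpM2r ?(ltW h0)// ler_nat; move: im; rewrite addnS ltnS.
move: i2; rewrite natrD mulrDl -natr1 mulrDl mul1r -pmulrn => i2.
by apply/andP; split; lra.
Qed.

(** Equals [g x - g eps] for [|x| <= eps]; outside, it is nonpositive, and nonzero only where [g] is
    below [- g eps]. *)
Definition peak {R : realType} (eps : R) (g : R -> R) (x : R) : R :=
  soft_threshold (g eps) (g x).

Section peak_theory.
Context {R : realType} {eps beta C : R} {g g1 g2 : R -> R}.
Implicit Types a x y : R.

Lemma profile_abs x : profile eps beta C g g1 g2 -> g x = g `|x|.
Proof. by move=> hg; case: (ger0P x) => // _; rewrite (profile_even hg). Qed.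

Lemma peak_near x : profile eps beta C g g1 g2 -> `|x| <= eps ->
  peak eps g x = g x - g eps.
Proof.
move=> hg xe; have h1 := profile_near hg _ _ (normr_ge0 x) xe (lexx eps).
have : 0 <= beta / 2 * (eps ^+ 2 - `|x| ^+ 2).
  apply: mulr_ge0; first by rewrite divr_ge0// ltW// (profile_beta hg).
  by rewrite subr_ge0 lerXn2r// nnegrE// (le_trans _ xe).
move: h1 (profile_pos hg); rewrite -(profile_abs x hg) => h1 h2 h3.
by rewrite /peak /soft_threshold; case: ltP => // h4; case: ltP => ?; lra.
Qed.

Lemma peak_far x : profile eps beta C g g1 g2 -> eps <= `|x| -> peak eps g x <= 0.
Proof.
move=> hg hx; have : g x <= g eps.
  have [e|e] := eqVneq eps `|x|; first by rewrite (profile_abs x hg) -e.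
  by apply/ltW/(profile_far hg); rewrite lt_neqAle e.
have := profile_pos hg => h1 h2; rewrite /peak /soft_threshold.
by case: ltP => h3; [lra|case: ltP => ?; lra].
Qed.

Lemma peak_ge0 x : profile eps beta C g g1 g2 -> `|x| <= eps -> 0 <= peak eps g x.
Proof.
move=> hg xe; have h1 := profile_near hg _ _ (normr_ge0 x) xe (lexx eps).
rewrite peak_near// (profile_abs x hg); apply: le_trans h1; apply: mulr_ge0.
  by rewrite divr_ge0// ltW// (profile_beta hg).
by rewrite subr_ge0 lerXn2r// nnegrE// (le_trans _ xe).
Qed.

Lemma peak_step a : profile eps beta C g g1 g2 -> eps / 4 <= `|a| -> `|a| <= eps / 2 ->
  3 / 8 * beta * eps ^+ 2 <= peak eps g a.
Proof.
move=> hg a1 a2; have e0 := profile_eps hg; have b0 := profile_beta hg.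
have ae : `|a| <= eps by lra.
rewrite peak_near// (profile_abs a hg).
apply: le_trans (profile_near hg _ _ (normr_ge0 a) ae (lexx eps)).
have -> : 3 / 8 * beta * eps ^+ 2 = beta / 2 * (eps ^+ 2 - (eps / 2) ^+ 2) by field.
rewrite ler_wpM2l//; first by rewrite divr_ge0// ltW.
by rewrite lerB// lerXn2r// nnegrE//; lra.
Qed.

(** Moving outward by [y] from [|a| >= eps / 4] inside the bump loses at least [beta * |a| * y].
    Once the bump is left, the whole height [3 / 8 * beta * eps ^ 2] is lost, which is enough
    because [y <= eps]. *)
Lemma peak_drop a x y : profile eps beta C g g1 g2 ->
  eps / 4 <= `|a| -> `|a| <= eps / 2 -> `|x| = `|a| + y -> 0 <= y -> y <= eps ->
  beta * eps / 4 * y <= peak eps g a - peak eps g x.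
Proof.
move=> hg a1 a2 xE y0 ye; have e0 := profile_eps hg; have b0 := profile_beta hg.
have [h|h] := leP `|x| eps.
  have ax : `|a| <= `|x| by lra.
  rewrite !peak_near ?(le_trans ax)// (profile_abs a hg) (profile_abs x hg).
  have := profile_near hg _ _ (normr_ge0 a) ax h; rewrite xE.
  have : 0 <= beta * y * (`|a| - eps / 4 + y / 2).
    by rewrite mulr_ge0//; [rewrite mulr_ge0// ltW|lra].
  by lra.
have h1 := peak_step a hg a1 a2; have h2 := peak_far x hg (ltW h).
have h3 : beta * eps / 4 * y <= beta * eps / 4 * eps.
  by rewrite ler_wpM2l// divr_ge0// mulr_ge0// ltW.
have h4 : 0 <= beta * eps ^+ 2 by rewrite mulr_ge0 ?sqr_ge0// ltW.
by move: h1; lra.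
Qed.

End peak_theory.

Lemma ler_size_sum {R : realType} {T : eqType} (l : seq T) (f : T -> R) (m : R) :
  {in l, forall k, m <= f k} -> (size l)%:R * m <= \sum_(k <- l) f k.
Proof.
elim: l => [|x l IH] h; first by rewrite big_nil mul0r.
rewrite big_cons /= -natr1 mulrDl mul1r addrC lerD ?h ?mem_head// IH// => k kl.
by apply: h; rewrite inE kl orbT.
Qed.

(** The sums [X + Y] and [Y + Z] differ by [X - Z >= m], so they cannot both be small. The factor
    [-1] matches [sg] in [soft_threshold_gap]. *)
Lemma sqr_two_steps {R : realType} (X Y Z m : R) : 0 <= m -> m <= X -> Z <= 0 ->
  m ^+ 2 / 2 <= (X - -1 * Y) ^+ 2 + (Y - -1 * Z) ^+ 2.
Proof.
move=> m0 mX Z0.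
have h4 : m ^+ 2 <= (X - Z) ^+ 2 by rewrite lerXn2r// ?nnegrE//; lra.
have := sqr_ge0 (X + 2 * Y + Z).
have -> : (X + 2 * Y + Z) ^+ 2 = 2 * ((X - -1 * Y) ^+ 2 + (Y - -1 * Z) ^+ 2) -
  (X - Z) ^+ 2 by ring.
by lra.
Qed.

(** Each bound restricts the sum of squares in [soft_threshold_gap] to grid points with [|k * h|] in
    [[eps / 4, eps / 2]], where the peak is at least [c1]. *)
Lemma peak_correlation {R : realType} (eps beta C h : R) (g g1 g2 : R -> R)
    (l0 : seq int) : profile eps beta C g g1 g2 -> 0 < h -> h <= eps / 8 ->
  (forall k : int, k \notin l0 -> `|g (k%:~R * h)| <= g eps) ->
  let Q j := rsum [set: int]
    (fun k => h * peak eps g (k%:~R * h) * g ((j - k)%:~R * h)) in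
  let c1 := 3 / 8 * beta * eps ^+ 2 in
  [/\ forall j : int, `|j%:~R * h| <= eps ->
        Q j <= Q 0 - eps / 16 * (beta * eps / 4) ^+ 2 * (j%:~R * h) ^+ 2,
      forall j : int, eps < `|j%:~R * h| -> Q j <= Q 0 - eps / 64 * c1 ^+ 2 &
      forall j : int, - (Q 0 - eps / 64 * c1 ^+ 2) <= Q j].
Proof.
move=> hg h0 he hl0 Q c1.
have e0 := profile_eps hg; have b0 := profile_beta hg.
pose G (k : int) := g (k%:~R * h); pose F (k : int) := peak eps g (k%:~R * h).
have Geven k : G (- k) = G k by rewrite /G mulrNz mulNr (profile_even hg).
pose Qs j := rsum [set: int] (fun k => soft_threshold (g eps) (G k) * G (j - k)).
have QE j : Q j = h * Qs j.
  rewrite /Q /Qs -rsumZ; last first.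
    apply: (ell1_finite_support l0) => k /hl0.
    rewrite -/(G k) ler_norml /soft_threshold => /andP[i1 i2].
    by case: ltP => [|_]; [lra|case: ltP => [|_]; [lra|rewrite mul0r]].
  by congr rsum; apply/funext => k; rewrite mulrA.
have th0 := ltW (profile_pos hg).
have gap0 (sg : R) (j : int) (l : seq int) : sg = 1 \/ sg = -1 -> uniq l ->
    h * (2^-1 * \sum_(k <- l) (F k - sg * F (k - j)) ^+ 2) <= Q 0 - sg * Q j.
  move=> hsg ul.
  have := soft_threshold_gap G l0 l (g eps) sg j Geven th0 hsg hl0 ul.
  lazy zeta beta; rewrite -!/(Qs _) => /(ler_wpM2l (ltW h0)) /le_trans; apply.
  by rewrite !QE mulrBr [h * (sg * _)]mulrCA.
have gap (sg : R) (j : int) (l : seq int) (m : R) : sg = 1 \/ sg = -1 -> uniq l ->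
    eps / 8 <= (size l)%:R * h -> 0 <= m ->
    {in l, forall k, m <= (F k - sg * F (k - j)) ^+ 2} ->
    eps / 16 * m <= Q 0 - sg * Q j.
  move=> hsg ul sl m0 hm; apply: le_trans (gap0 sg j l hsg ul).
  have h3 : eps / 8 * m <= (size l)%:R * h * m by rewrite ler_wpM2r.
  by have := ler_wpM2l (ltW h0) (ler_size_sum l _ m hm); lra.
have [l [ul sl hl]] := lattice_count eps h h0 e0 he.
have abs_l k : k \in l -> `|k%:~R * h| = k%:~R * h.
  by move=> /hl/andP[k1 _]; rewrite ger0_norm//; lra.
have c10 : 0 <= c1 by rewrite /c1 !mulr_ge0 ?sqr_ge0// ltW.
have Fstep k : k \in l -> c1 <= F k /\ c1 <= F (- k).
  move=> kl; have /andP[k1 k2] := hl k kl.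
  by rewrite /F mulrNz mulNr; split; apply: (peak_step _ hg); rewrite ?normrN abs_l.
(* The side of the origin is chosen opposite to [j], so that [k - j] is farther from the origin by
   exactly [|j * h|]. *)
have outward (j : int) : exists l' : seq int, [/\ uniq l', size l' = size l &
    {in l', forall k, [/\ eps / 4 <= `|k%:~R * h|, `|k%:~R * h| <= eps / 2, c1 <= F k,
      `|(k - j)%:~R * h| = `|k%:~R * h| + `|j%:~R * h| &
      `|(- k - j)%:~R * h| = `| `|k%:~R * h| - `|j%:~R * h| | ]}].
  have [y0|y0] := leP (j%:~R * h) 0.
    exists l; split=> // k kl; have /andP[k1 k2] := hl k kl.
    have [f1 _] := Fstep k kl.
    split; rewrite ?(abs_l k kl)//.
      by rewrite intrB mulrBl (ler0_norm y0) ger0_norm; lra.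
    rewrite intrB mulrBl mulrNz mulNr (ler0_norm y0) opprK -normrN.
    by congr (`|_|); lra.
  exists [seq - k | k <- l]; split; rewrite ?size_map//.
    by rewrite map_inj_uniq//; exact: oppr_inj.
  move=> x /mapP[k kl ->]; have /andP[k1 k2] := hl k kl.
  have [_ f2] := Fstep k kl.
  have kE : `|(- k)%:~R * h| = k%:~R * h by rewrite mulrNz mulNr normrN abs_l.
  split; rewrite ?kE//.
    by rewrite intrB mulrBl mulrNz mulNr (gtr0_norm y0) ler0_norm; lra.
  by rewrite opprK intrB mulrBl (gtr0_norm y0).
split=> j.
- move=> jeps; have [l' [ul' sl' hl']] := outward j.
  have := gap 1 j l' ((beta * eps / 4 * `|j%:~R * h|) ^+ 2) (or_introl erefl) ul'.
  rewrite sl' => /(_ sl (sqr_ge0 _)) h1.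
  suff : eps / 16 * (beta * eps / 4 * `|j%:~R * h|) ^+ 2 <= Q 0 - 1 * Q j.
    by rewrite exprMn real_normK ?num_real// mul1r mulrA; clear; lra.
  apply: h1 => k /hl'[k1 k2 _ kj _]; rewrite mul1r.
  have hd := peak_drop _ _ _ hg k1 k2 kj (normr_ge0 _) jeps.
  have p0 : 0 <= beta * eps / 4 * `|j%:~R * h|.
    by rewrite !mulr_ge0// ltW.
  by rewrite lerXn2r// ?nnegrE//; apply: le_trans hd.
- move=> jeps; have [l' [ul' sl' hl']] := outward j.
  have := gap 1 j l' (c1 ^+ 2) (or_introl erefl) ul'.
  rewrite sl' => /(_ sl (sqr_ge0 _)) h1.
  have h2 : eps / 16 * c1 ^+ 2 <= Q 0 - 1 * Q j.
    apply: h1 => k /hl'[k1 k2 fk kj _]; rewrite mul1r.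
    have : F (k - j) <= 0.
      by apply: (peak_far _ hg); rewrite kj ler_wpDl// ltW.
    by move=> fkj; rewrite lerXn2r// ?nnegrE//; move: c10 fk fkj; clear; lra.
  have h3 : 0 <= eps * c1 ^+ 2 by rewrite mulr_ge0 ?sqr_ge0// ltW.
  by lra.
have h3 : 0 <= eps * c1 ^+ 2 by rewrite mulr_ge0 ?sqr_ge0// ltW.
have [l' [ul' sl' hl']] := outward j.
have [jeps|jeps] := leP `|j%:~R * h| eps.
  (* From the mirrored points the shift by [j] moves toward the origin, possibly past it, and stays
     within the bump. Both values are then nonnegative and the first is at least [c1]. *)
  have := gap (-1) j [seq - k | k <- l'] (c1 ^+ 2) (or_intror erefl).
  rewrite map_inj_uniq; last exact: oppr_inj.
  rewrite size_map sl' => /(_ ul' sl (sqr_ge0 _)) h1.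
  suff : eps / 16 * c1 ^+ 2 <= Q 0 - -1 * Q j by move: h3; clear; lra.
  apply: h1 => x /mapP[k /hl'[k1 k2 fk _ kj] ->]; rewrite mulN1r opprK.
  have Fk : F (- k) = F k by rewrite /F mulrNz mulNr /peak (profile_even hg).
  have : 0 <= F (- k - j).
    apply: (peak_ge0 _ hg); rewrite kj ler_norml.
    by move: (normr_ge0 (j%:~R * h)) jeps k1 k2 e0; clear => *; apply/andP; split; lra.
  by move=> fkj; rewrite Fk lerXn2r// ?nnegrE//; move: c10 fk fkj; clear; lra.
(* [F] is positive at [k] and nonpositive at [k - 2 j], so it cannot be close to
   changing sign under both shifts by [j]. *)
have u2 : uniq [seq k - j | k <- l].
  by rewrite map_inj_uniq//; exact: addIr.
have g1' := gap0 (-1) j l (or_intror erefl) ul.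
have := gap0 (-1) j _ (or_intror erefl) u2; rewrite big_map => g2'.
have hm : {in l, forall k, c1 ^+ 2 / 2 <= (F k - -1 * F (k - j)) ^+ 2 +
    (F (k - j) - -1 * F (k - j - j)) ^+ 2}.
  move=> k kl; have [f1 _] := Fstep k kl; have /andP[k1 k2] := hl k kl.
  have fz : F (k - j - j) <= 0.
    apply: (peak_far _ hg); rewrite !intrB !mulrBl.
    have := lerB_dist (j%:~R * h + j%:~R * h) (k%:~R * h).
    have -> : `|j%:~R * h + j%:~R * h| = 2 * `|j%:~R * h|.
      by rewrite -mulr2n normrMn mulr_natl.
    by rewrite (abs_l k kl) distrC opprD addrA; move: k2 jeps e0; clear; lra.
  exact: sqr_two_steps.
(* The constant [eps / 64] is [eps / 8] halved three times: in [soft_threshold_gap], in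
   [sqr_two_steps], and on averaging the two gaps. *)
have := ler_size_sum l _ _ hm; rewrite big_split /= => /(ler_wpM2l (ltW h0)) h4.
have h5 : eps / 8 * (c1 ^+ 2 / 2) <= (size l)%:R * h * (c1 ^+ 2 / 2).
  by rewrite ler_wpM2r// divr_ge0// sqr_ge0.
by move: g1' g2' h4 h5; clear; lra.
Qed.
(** * Certificates on fine grids *)

(* Coefficients of a discrete derivative: correlated with the kernel they give a
   function vanishing at [0] with nonzero slope there. *)
Definition doublet {R : realType} (eps h : R) (k : int) : R :=
  if eps / 4 <= k%:~R * h <= eps / 2 then h
  else if eps / 4 <= - (k%:~R * h) <= eps / 2 then - h else 0.

Lemma doublet_odd {R : realType} (eps h : R) (k : int) : 0 < eps ->
  doublet eps h (- k) = - doublet eps h k.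
Proof.
move=> e0; rewrite /doublet mulrNz mulNr opprK.
case: ifP => [/andP[h1 h2]|_]; last by case: ifP => //; rewrite ?opprK ?oppr0.
by case: ifP => [/andP[h3 h4]|]; [lra|rewrite opprK].
Qed.

Lemma doublet_bound {R : realType} (eps h : R) (k : int) : 0 < h ->
  `|doublet eps h k| <= h.
Proof.
move=> h0; rewrite /doublet; case: ifP => _; first by rewrite gtr0_norm.
by case: ifP => _; rewrite ?normrN ?normr0 ?gtr0_norm// ltW.
Qed.

Lemma doublet_far {R : realType} (eps h : R) (k : int) : 0 < eps ->
  eps < `|k%:~R * h| -> doublet eps h k = 0.
Proof.
move=> e0 hk; rewrite /doublet.
case: ifP => [/andP[h1 h2]|_]; first by move: hk; rewrite ger0_norm; lra.
by case: ifP => [/andP[h1 h2]|//]; move: hk; rewrite ler0_norm; lra.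
Qed.

(** Both factors are odd, so every term is nonnegative. The positive half alone gives mass [eps / 8]
    times the slope [beta * eps / 4]. *)
Lemma doublet_slope {R : realType} (eps beta C h : R) (g g1 g2 : R -> R) :
  profile eps beta C g g1 g2 -> 0 < h -> h <= eps / 8 ->
  ell1 (fun k => doublet eps h k * g1 ((0 - k)%:~R * h)) ->
  beta * eps ^+ 2 / 32 <=
  rsum [set: int] (fun k => doublet eps h k * g1 ((0 - k)%:~R * h)).
Proof.
move=> hg h0 he hl1; have e0 := profile_eps hg; have b0 := profile_beta hg.
have slope x : eps / 4 <= x -> x <= eps / 2 -> beta * (eps / 4) <= - g1 x.
  move=> x1 x2; have h1 := profile_slope hg x.
  have h2 : g1 x <= - beta * x by apply: h1; lra.
  have h3 : beta * (eps / 4) <= beta * x by rewrite ler_wpM2l// ltW.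
  by lra.
have be0 : 0 <= beta * (eps / 4) by rewrite mulr_ge0 ?divr_ge0// ltW.
have [l [ul sl hl]] := lattice_count eps h h0 e0 he.
have term0 k : 0 <= doublet eps h k * g1 ((0 - k)%:~R * h).
  rewrite sub0r mulrNz mulNr (profile_odd hg) /doublet.
  case: ifP => [/andP[k1 k2]|_].
    by apply: mulr_ge0; [exact: ltW|exact: le_trans (slope _ k1 k2)].
  case: ifP => [/andP[k1 k2]|_]; last by rewrite mul0r.
  rewrite mulrNN -[k%:~R * h]opprK (profile_odd hg) mulr_ge0//; first exact: ltW.
  exact: le_trans (slope _ k1 k2).
apply: le_trans (ler_sum_rsum l _ ul hl1 term0).
apply: le_trans (ler_size_sum l _ (h * (beta * (eps / 4))) _).
  have := ler_wpM2r be0 sl.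
  by rewrite mulrA; lra.
move=> k /hl kl; have /andP[k1 k2] := kl.
rewrite /doublet kl sub0r mulrNz mulNr (profile_odd hg) ler_wpM2l//; first exact: ltW.
exact: slope.
Qed.

Lemma peak_bound {R : realType} (eps beta C : R) (g g1 g2 : R -> R) (x : R) :
  profile eps beta C g g1 g2 -> `|peak eps g x| <= C.
Proof.
move=> hg; have C0 := profile_C hg; have g0 := profile_pos hg.
have : `|g x| <= C.
  apply: le_trans (profile_decay hg x) _; rewrite ler_pdivrMr.
    by have := mulr_ge0 (ltW C0) (sqr_ge0 x); lra.
  by rewrite ltr_pwDl// sqr_ge0.
rewrite ler_norml => /andP[h1 h2]; rewrite /peak /soft_threshold ler_norml.
case: ltP => h3; first by apply/andP; split; lra.
by case: ltP => h4; apply/andP; split; lra.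
Qed.

Lemma comb_decays {R : realType} (h : R) (M : nat) (w : int -> R) (f : R -> R)
    (C W T K : R) : 0 <= C -> (forall t, `|f t| <= C / (1 + t ^+ 2)) ->
  (forall k, `|w k| <= W) -> 0 <= h -> 0 < T -> M%:R * h <= T ->
  M.*2.+1%:R * W * (4 * C) <= K -> decays K T (comb h M w f).
Proof.
move=> C0 hf hw h0 T0 Mh hK t.
have [h1 h2] := comb_bound h M w f C W T C0 hf hw h0 T0 Mh t.
split; first exact: le_trans hK.
by move=> /h2 /le_trans; apply; rewrite ler_wpM2r// invr_ge0 sqr_ge0.
Qed.

Lemma fine_certifiable {R : realType} (eps beta C : R) (g g1 g2 : R -> R) :
  profile eps beta C g g1 g2 ->
  exists h1 nu0, 0 < h1 /\ forall nu h, nu0 <= nu -> 0 < h -> h <= h1 ->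
    certifiable eps beta g h nu.
Proof.
move=> hg; have [T0 [T00 hT]] := profile_radius _ _ _ _ _ _ hg.
have C0 := profile_C hg; have e0 := profile_eps hg.
have b0 := profile_beta hg; have g0 := profile_pos hg.
have [T [Te TT0 Tpos]] : exists T : R, [/\ eps <= T, T0 <= T & 0 < T].
  by exists (T0 + eps); split; lra.
(* The weights are at most [h * (C + 1)] and [(2 * M + 1) * h <= 2 * T + 1], so [K] is uniform in
   [h <= 1]. *)
have [K [K0 KE]] : exists K : R, 0 < K /\ (2 * T + 1) * (C + 1) * (4 * C) <= K.
  by exists ((2 * T + 1) * (C + 1) * (4 * C)); rewrite lexx !mulr_gt0//; lra.
pose c1 := 3 / 8 * beta * eps ^+ 2.
have c10 : 0 < c1 by rewrite /c1 !mulr_gt0// exprn_gt0.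
have A10 : 0 < eps / 16 * (beta * eps / 4) ^+ 2.
  by rewrite mulr_gt0 ?exprn_gt0 ?divr_gt0// mulr_gt0.
have A20 : 0 < eps / 64 * c1 ^+ 2 by rewrite mulr_gt0 ?exprn_gt0 ?divr_gt0.
have [c [c0 cA1 cA2]] : exists c : R, [/\ 0 < c,
    c <= eps / 16 * (beta * eps / 4) ^+ 2 & c <= eps / 64 * c1 ^+ 2].
  exists (Num.min (eps / 16 * (beta * eps / 4) ^+ 2) (eps / 64 * c1 ^+ 2)).
  by rewrite lt_min A10 A20 !ge_min !lexx orbT.
have A30 : 0 < beta * eps ^+ 2 / 32 by rewrite divr_gt0// mulr_gt0// exprn_gt0.
(* The bound [- (Q 0 - gap) <= Q 0] only yields [Q 0 >= gap / 2], whence the extra division by 2. *)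
have [d [d0 dA2 dA3]] : exists d : R, [/\ 0 < d,
    d <= eps / 64 * c1 ^+ 2 / 2 & d <= beta * eps ^+ 2 / 32].
  exists (Num.min (eps / 64 * c1 ^+ 2 / 2) (beta * eps ^+ 2 / 32)).
  by rewrite lt_min A30 divr_gt0// !ge_min !lexx orbT.
(* With this choice the smallness condition of [fine_certificate] becomes [X <= nu ^ 2]. *)
pose X := 2 / d * (2 * (K * 16)) * (2 + K / d) * (8 * K) / c.
have X0 : 0 < X.
  have Kd : 0 < K / d by rewrite divr_gt0.
  by rewrite divr_gt0// !mulr_gt0 ?invr_gt0//; lra.
(* The last bound serves the constant 16: [P] is of order [h] and [gamma ^ 2] is [h ^ -2], so the
   condition amounts to [h ^ 3 * K * (C + 1) * beta <= 2 * c * d]. *)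
pose h1 := Num.min (Num.min 1 (eps / 8)) (2 * c * d / (K * (C + 1) * beta)).
have Cp : 0 < C + 1 by lra.
have h10 : 0 < h1.
  by rewrite !lt_min ltr01 !divr_gt0 ?mulr_gt0.
exists h1, (4 * T + 2 * eps + 1 + X); split=> // nu h hnu h0 hh1.
have h11 : h <= 1 by apply: le_trans hh1 _; rewrite !ge_min lexx.
have he : h <= eps / 8 by apply: le_trans hh1 _; rewrite !ge_min lexx orbT.
have hcd : h <= 2 * c * d / (K * (C + 1) * beta).
  by apply: le_trans hh1 _; rewrite !ge_min lexx orbT.
have nu1 : 1 <= nu by move: hnu X0 Tpos e0; clear; lra.
have nu0 : 0 < nu := lt_le_trans ltr01 nu1.
have small : 2 / d * (2 * (K * (16 / nu ^+ 2))) * (2 + K / d) <= c / (8 * K).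
  have -> : 2 / d * (2 * (K * (16 / nu ^+ 2))) * (2 + K / d) =
      X * (c / (8 * K)) / nu ^+ 2.
    by rewrite /X; field; rewrite !gt_eqF.
  rewrite ler_pdivrMr ?exprn_gt0// mulrC ler_wpM2l//.
    by rewrite divr_ge0 ?ltW// mulr_gt0.
  by apply: le_trans (ler_peMl (ltW nu0) nu1); move: hnu Tpos e0; clear; lra.
have [] := lattice_radius h T h0 (ltW Tpos).
set M := Num.truncn _ => Mh hM.
pose w0 k := h * peak eps g (k%:~R * h); pose w1 := doublet eps h.
have w0b k : `|w0 k| <= h * C.
  by rewrite normrM gtr0_norm// ler_wpM2l ?(ltW h0)//; exact: (peak_bound _ _ _ _ _ _ _ hg).
have w1b k : `|w1 k| <= h by exact: doublet_bound.
have w0s k : (M < absz k)%N -> w0 k = 0.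
  move=> /hM hk; have := hT (k%:~R * h) (le_lt_trans TT0 hk).
  rewrite ler_norml /w0 /peak /soft_threshold => /andP[i1 i2].
  by rewrite !ltNge i1 i2 mulr0.
have w1s k : (M < absz k)%N -> w1 k = 0.
  by move=> /hM hk; apply: doublet_far => //; exact: le_lt_trans hk.
have ell1w (w : int -> R) f : (forall k, (M < absz k)%N -> w k = 0) ->
    ell1 (fun k => w k * f k).
  move=> hw; apply: (ell1_finite_support (codom (lattice M))) => k hk.
  by rewrite hw ?mul0r// ltnNge; apply: contra hk; exact: lattice_codom.
have KW : M.*2.+1%:R * (h * (C + 1)) * (4 * C) <= K.
  apply: le_trans KE; rewrite mulrA ler_wpM2r//; first by rewrite mulr_ge0// ltW.
  rewrite ler_wpM2r ?(ltW Cp)// -natr1 -muln2 natrM; move: Mh h11; clear; lra.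
have w0W k : `|w0 k| <= h * (C + 1) by apply: le_trans (w0b k) _; rewrite ler_wpM2l ?(ltW h0)// lerDl.
have w1W k : `|w1 k| <= h * (C + 1).
  by apply: le_trans (w1b k) _; rewrite ler_peMr ?(ltW h0)// lerDr ltW.
have dec (w : int -> R) (f : R -> R) : (forall k, `|w k| <= h * (C + 1)) ->
    (forall t, `|f t| <= C / (1 + t ^+ 2)) -> decays K T (comb h M w f).
  by move=> hw hf; apply: (comb_decays h M w f C _ T K (ltW C0) hf hw (ltW h0) Tpos Mh KW).
have zero f w : (forall k, (M < absz k)%N -> w k = 0) ->
    comb h M w f 0 = rsum [set: int] (fun k => w k * f ((0 - k)%:~R * h)).
  by move=> hw; rewrite -(comb_rsum h M)// mul0r.
have hl0 k : k \notin codom (lattice M) -> `|g (k%:~R * h)| <= g eps.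
  move=> hk; apply: hT; apply: le_lt_trans TT0 (hM _ _); rewrite ltnNge.
  by apply: contra hk; exact: lattice_codom.
have := peak_correlation eps beta C h g g1 g2 _ hg h0 he hl0.
lazy zeta beta; rewrite -/c1 => -[near far plus].
have QE (j : int) : comb h M w0 g (j%:~R * h) = rsum [set: int] (fun k =>
    h * peak eps g (k%:~R * h) * g ((j - k)%:~R * h)).
  by rewrite comb_rsum.
have Q0E : comb h M w0 g 0 = rsum [set: int] (fun k =>
    h * peak eps g (k%:~R * h) * g ((0 - k)%:~R * h)) := zero g w0 w0s.
have d4 : d <= comb h M w0 g 0 by rewrite Q0E; move: (plus 0) dA2; clear; lra.
have {}plus (j : int) : - (comb h M w0 g 0 - c) <= comb h M w0 g (j%:~R * h).
  by move: (plus j) cA2; rewrite QE Q0E; clear; lra.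
exists (2 / d * (h * (C + 1))), (c / (2 * K)); split.
- by rewrite mulr_ge0 ?divr_ge0 ?mulr_ge0 ?ltW.
- by rewrite divr_gt0// mulr_gt0.
- rewrite max_l; last by rewrite lef_pV2//; move: he e0; clear; lra.
  move: hcd; rewrite ler_pdivlMr ?mulr_gt0// => hcd.
  have h3 : h ^+ 2 * (h * (K * (C + 1) * beta)) <= 1 * (2 * c * d).
    apply: ler_pM => //; first exact: sqr_ge0.
      by rewrite !mulr_ge0 ?ltW.
    by rewrite expr_le1// ltW.
  have -> : 2 * (2 / d * (h * (C + 1))) =
    (h ^+ 2 * (h * (K * (C + 1) * beta))) * (4 / (d * h ^+ 2 * K * beta)).
    by field; rewrite !gt_eqF.
  have -> : c / (2 * K) * (16 * h^-1 ^+ 2 / beta) =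
    1 * (2 * c * d) * (4 / (d * h ^+ 2 * K * beta)).
    by field; rewrite !gt_eqF.
  by rewrite ler_wpM2r// divr_ge0 ?ltW// !mulr_gt0 ?exprn_gt0.
move=> I t s sep hs.
apply: (fine_certificate g g1 g2 h T nu K d c eps _ M w0 w1) => //.
- exact: profile_derive hg.
- exact: profile_derive2 hg.
- by move: hnu X0 e0; clear; lra.
- by move: hnu X0 Tpos; clear; lra.
- by apply: dec => //; exact: profile_decay hg.
- by apply: dec => //; exact: profile_decay1 hg.
- by apply: dec => //; exact: profile_decay2 hg.
- by apply: dec => //; exact: profile_decay hg.
- by apply: dec => //; exact: profile_decay1 hg.
- by apply: dec => //; exact: profile_decay2 hg.
(* Even weights against the odd derivative; the next case pairs odd weights with the even kernel. *)
- rewrite zero//; apply: rsum_odd; first exact: ell1w.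
  move=> k; have -> : w0 (- k) = w0 k.
    by rewrite /w0 mulrNz mulNr /peak (profile_even hg).
  have -> : (0 - - k)%:~R * h = - ((0 - k)%:~R * h).
    by rewrite !sub0r !mulrNz opprK mulNr opprK.
  by rewrite (profile_odd hg) mulrN.
- rewrite zero//; apply: rsum_odd; first exact: ell1w.
  move=> k; rewrite /w1 doublet_odd//.
  have -> : (0 - - k)%:~R * h = - ((0 - k)%:~R * h).
    by rewrite !sub0r !mulrNz opprK mulNr opprK.
  by rewrite (profile_even hg) mulNr.
- rewrite zero//; apply: le_trans dA3 _.
  exact: (doublet_slope eps beta C h g g1 g2 hg h0 he (ell1w _ _ w1s)).
- move=> j jeps; rewrite QE Q0E; apply: le_trans (near j jeps) _.
  by rewrite lerB// ler_wpM2r// sqr_ge0.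
- move=> j jeps; rewrite QE Q0E; apply: le_trans (far j jeps) _.
  by rewrite lerB.
- move=> k; rewrite ler_wpM2l ?divr_ge0 ?(ltW d0)//.
  by move: (w0b k) (w1b k); clear; lra.
Qed.

(** * The recovery bound *)

Lemma spike_trainE {R : realType} (K : set int) (c : int -> R) :
  spike_train K c = (fun k => if k \in K then c k else 0).
Proof.
apply/funext => k; rewrite /spike_train /weighted_shifts rsum_indic.
rewrite (rsum_finite_support [:: k])//.
  by rewrite big_seq1 /kronecker subrr eqxx mulr1.
move=> m; rewrite inE /kronecker subr_eq0 eq_sym => /negPf ->.
by rewrite mulr0 if_same.
Qed.

Lemma weighted_shifts_conv {R : realType} (K : set int) (c a : int -> R) :
  weighted_shifts K c a = convZ a (spike_train K c).
Proof.
rewrite spike_trainE; apply/funext => k; rewrite /weighted_shifts rsum_indic.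
congr rsum; apply/funext => m; case: ifP => _; first by rewrite mulrC.
by rewrite mulr0.
Qed.

Lemma norm1_sum_le {R : realType} (f : int -> R) (d : R) (l : seq int) :
  uniq l -> (norm1 f <= d%:E)%E -> \sum_(k <- l) `|f k| <= d.
Proof.
move=> ul hf; have hl : ell1 f by apply: le_lt_trans hf _; exact: ltry.
rewrite -lee_fin; apply: le_trans hf; rewrite norm1_rsum// lee_fin.
by apply: ler_sum_rsum => //; exact: ell1_abs.
Qed.

(** The fine regime fixes the step [h1] first; the coarse regime then covers all [h >= h1]. The
    summand 1 makes the inequality for [nu0] strict. *)
Lemma admissible_certifiable {R : realType} (eps beta : R) (g : R -> R) :
  0 < eps -> 0 < beta -> admissible_kernel eps beta g ->
  exists nu0, Num.max eps beta < nu0 /\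
    forall nu h, nu0 <= nu -> 0 < h -> certifiable eps beta g h nu.
Proof.
move=> e0 b0 /(admissible_profile _ _ _ e0 b0)[C [g1 [g2 hg]]].
have [h1 [nu1 [h10 fine]]] := fine_certifiable _ _ _ _ _ _ hg.
have [nu2 coarse] := coarse_certifiable _ _ _ h1 _ _ _ hg h10.
exists (Num.max (Num.max nu1 nu2) (Num.max eps beta + 1)); split.
  by rewrite lt_max ltrDl ltr01 orbT.
move=> nu h; rewrite !ge_max => /andP[/andP[n1 n2] _] h0.
by have [hh|/ltW hh] := leP h h1; [exact: fine|exact: coarse].
Qed.

Theorem corollary2p9 (R : realType) (g : R -> R) (eps beta : R)
    (heps : 0 < eps) (hbeta : 0 < beta)
    (hg : admissible_kernel eps beta g) :
  exists nu0 : R, Num.max eps beta < nu0 /\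
    forall (nu : R), nu0 <= nu ->
    forall (sigma N d : R), 0 < sigma -> 0 < N -> 0 <= d ->
    forall (K : set int) (c eta : int -> R),
      min_separated K (N * nu * sigma) ->
      (forall m, K m -> c m != 0) ->
      ell1 (spike_train K c) ->
      (norm1 eta <= d%:E)%E ->
    let gs := sampled_kernel g sigma N in
    let gamma := Num.max (N * sigma) eps^-1 in
    let y := weighted_shifts K c gs \+ eta in
    forall (Khat : set int) (chat : int -> R),
      (forall n, Khat n -> chat n != 0) ->
      solves_program gs y d (spike_train Khat chat) ->
    let Khat_far := Zfar K (N * eps * sigma) `&` Khat in
    (\esum_(n in Khat_far) `|chat n|%:E <= (16 * gamma ^+ 2 / beta * d)%:E)%E.
Proof.
have [nu0 [nu0_gt cert]] := admissible_certifiable _ _ _ heps hbeta hg.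
exists nu0; split=> // nu nu_ge sigma N d s0 N0 d0 K c eta sep _ hx heta.
move=> gs gamma y Khat chat _ [[hz feas] opt].
lazy zeta; set Khat_far := Zfar K _ `&` Khat.
set x := spike_train K c in hx; set z := spike_train Khat chat in hz feas opt.
have yE : y = convZ gs x \+ eta by rewrite /y weighted_shifts_conv.
have sN0 : 0 < sigma * N by rewrite mulr_gt0.
pose h := (sigma * N)^-1; have h0 : 0 < h by rewrite invr_gt0.
have gammaE : gamma = Num.max h^-1 eps^-1 by rewrite /gamma /h invrK mulrC.
have [P [rho [P0 rho0 Prho certh]]] := cert nu h nu_ge h0.
(* The true signal [x] is feasible, its residual being [eta]. *)
have hzx : rsum [set: int] (fun k => `|z k|) <= rsum [set: int] (fun k => `|x k|).
  rewrite -lee_fin -(norm1_rsum _ hz) -(norm1_rsum _ hx); apply: opt; split; first exact: hx.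
  have -> : y \- convZ gs x = eta by apply/funext => k; rewrite yE /= addrAC subrr add0r.
  exact: heta.
(* Both residuals have norm at most [d], so the two convolutions differ by at most [2 * d]. *)
have hD (l : seq int) : uniq l ->
    \sum_(k <- l) `|convZ gs x k - convZ gs z k| <= 2 * d.
  move=> ul; have h1 := norm1_sum_le _ _ l ul heta.
  have h2 := norm1_sum_le _ _ l ul feas.
  apply: (@le_trans _ _ (\sum_(k <- l) (`|(y \- convZ gs z) k| + `|eta k|))).
    apply: ler_sum => k _; apply: le_trans (ler_normB _ _).
    by rewrite yE /= le_eqVlt; apply/orP; left; apply/eqP; congr (`|_|); lra.
  by rewrite big_split /=; lra.
have [C [g1 [g2 hp]]] := admissible_profile _ _ _ heps hbeta hg.
have far_le : rho * rsum Khat_far (fun k => `|z k|) <= P * (2 * d).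
  (* The certificate interpolates only the spikes in a finite list [l]; those left out have mass at
     most [tau / 2], and [tau] is arbitrary. *)
  apply/ler_addgt0Pr => tau tau0.
  have tau2 : 0 < tau / 2 by rewrite divr_gt0.
  have [l [ul lx hl]] := rsum_tail x (tau / 2) hx tau2.
  pose t (i : 'I_(size l)) := tnth (in_tuple l) i.
  have t_inj : injective t by exact/(tuple_uniqP (in_tuple l)).
  have tl i : t i \in l by exact: mem_tnth.
  have Kt i : K (t i).
    have := lx _ (tl i); rewrite /x spike_trainE.
    by case: ifP => [|_]; [rewrite inE|rewrite eqxx].
  have sept i j : i != j -> nu <= `|(t i)%:~R * h - (t j)%:~R * h|.
    move=> ij; rewrite -mulrBl -intrB normrM (gtr0_norm h0) ler_pdivlMr//.
    have := sep (t i) (t j) (Kt i) (Kt j); rewrite inj_eq// intr_norm => /(_ ij).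
    by apply: le_trans; rewrite le_eqVlt; apply/orP; left; apply/eqP; ring.
  have sgt i : `|Num.sg (x (t i))| = 1 by rewrite normr_sg lx.
  have := certh _ t (fun i => Num.sg (x (t i))) sept sgt.
  have -> : (fun k : int => g (k%:~R * h)) = gs by [].
  move=> /(certificate_far _ _ _ _ Khat_far) ct.
  have -> : P * (2 * d) + tau = P * (2 * d) + 2 * (tau / 2) by field.
  apply: (certificate_bound gs x z _ t Khat_far P rho (2 * d) (tau / 2) C) => //.
  - by move=> k; rewrite /gs /sampled_kernel mulrNz mulNr (profile_even hp).
  - move=> k; apply: le_trans (profile_decay hp _) _; rewrite ler_pdivrMr.
      by have := mulr_ge0 (ltW (profile_C hp)) (sqr_ge0 (k%:~R / (sigma * N))); lra.
    by rewrite ltr_pwDl// sqr_ge0.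
  - apply: le_trans hl; rewrite le_eqVlt; apply/orP; left; apply/eqP.
    congr rsum; apply/funext => k; congr (if _ then _ else _).
    apply/codomP/idP => [[i ->]//|kl].
    by have /tnthP[i ki] : k \in in_tuple l by []; exists i.
  - apply: ct => k [kfar _] i; rewrite -mulrBl -intrB normrM (gtr0_norm h0).
    rewrite ltr_pdivlMr//; have := kfar _ (Kt i); rewrite intr_norm.
    by apply: le_lt_trans; rewrite le_eqVlt; apply/orP; left; apply/eqP; ring.
have -> : (\esum_(n in Khat_far) `|chat n|%:E)%E =
    (rsum Khat_far (fun k => `|z k|))%:E.
  rewrite rsum_indic -esum_rsum; last 2 first.
  - apply: ell1_le hz _ => k; case: ifP => _; last by rewrite normr0.
    by rewrite normr_id.
  - by move=> k; case: ifP.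
  rewrite esum_mkcond; apply: eq_esum => k _; case: ifP => //.
  by rewrite inE => -[_ kK]; rewrite /z spike_trainE mem_set.
rewrite lee_fin gammaE -(ler_pM2l rho0); apply: le_trans far_le _.
have := ler_wpM2r d0 Prho; lra.
Qed.
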